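(* Let $G$ be a polyhedron with $p=|V(G)|$, maximum degree $\Delta$ and $L=L(G)$. If $G$ is not isomorphic to any of $T_m$ ($m\geq 3$), $B_\ell$ or $B'_\ell$ ($\ell\geq 5$), $K_4$, $B_4$, $S_5$, $S_7$, then for every integer $n\geq 3$: $A_n(G)=\{0,1,2\}$ if $n\leq L$; $A_n(G)=\{0,1\}$ if $L<n\leq\Delta$; $A_n(G)=\{0\}$ if $\Delta<n\leq p$; and $A_n(G)=\emptyset$ if $n>p$. In the exceptional cases: - for $m\geq 3$: $A_3(T_m)=\{1,2\}$; $A_n(T_m)=\{0,1,2\}$ for $4\leq n\leq m$; $A_{m+1}(T_m)=\{0,1\}$; $A_{m+2}(T_m)=\{0\}$; $A_n(T_m)=\emptyset$ for $n>m+2$; - for $\ell\geq 5$ and $G\in\{B_\ell,B'_\ell\}$: $A_3(G)=A_4(G)=\{0,1,2\}$; $A_n(G)=\{0,2\}$ for $5\leq n\leq\ell$; $A_{\ell+1}(G)=A_{\ell+2}(G)=\{0\}$; $A_n(G)=\emptyset$ for $n>\ell+2$; - $A_3(K_4)=\{1\}$, $A_4(K_4)=\{0\}$, $A_n(K_4)=\emptyset$ for $n\geq5$; - $A_3(B_4)=A_4(B_4)=\{0,2\}$, $A_5(B_4)=A_6(B_4)=\{0\}$, $A_n(B_4)=\emptyset$ for $n\geq 7$; - $A_3(S_5)=\{1,2\}$, $A_4(S_5)=\{0,1,2\}$, $A_5(S_5)=A_6(S_5)=\{0,1\}$, $A_7(S_5)=\{0\}$, $A_n(S_5)=\emptyset$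 for $n\geq 8$; - $A_3(S_7)=\{1,2\}$, $A_4(S_7)=\{0,1,2\}$, $A_5(S_7)=A_6(S_7)=\{0,1\}$, $A_7(S_7)=A_8(S_7)=\{0\}$, $A_n(S_7)=\emptyset$ for $n\geq 9$.
   Context: All graphs are simple and finite. A polyhedron is a planar, $3$-connected graph. For distinct vertices $u_1,\dots,u_n$ of $G$, $N(u_1,\dots,u_n)$ is the set of vertices adjacent to all of them, and $A_n(G):=\{a : \exists \text{ distinct } u_1,\dots,u_n\in V(G) \text{ with } |N(u_1,\dots,u_n)|=a\}$. $L(G):=\max\{\ell\in\mathbb{N} : G \text{ contains } K_{2,\ell} \text{ as a subgraph}\}$. $G_1+G_2$ denotes the join (disjoint union together with all edges between $V(G_1)$ and $V(G_2)$); $C_\ell,P_\ell$ are the cycle and the path on $\ell$ vertices; $\overline{K_2}$ is the edgeless graph on two vertices. $T_m:=P_m+K_2$; $B_\ell:=C_\ell+\overline{K_2}$; $B'_\ell:=P_\ell+\overline{K_2}$. $S_5$ is obtained from $K_4$ with vertices $a,b,c,d$ by adding three new vertices, adjacent respectively to exactly $\{a,b,c\}$, $\{a,b,d\}$, $\{a,c,d\}$. $S_7$ is obtained from $K_4$ with vertices $a,b,c,d$ by adding four new vertices, adjacent respectively to exactly $\{a,b,c\}$, $\{a,b,d\}$, $\{a,c,d\}$, $\{b,c,d\}$. *)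

(* Defs.v *)
From HB Require Import structures.
From mathcomp Require Import all_boot all_order all_algebra.
From mathcomp Require Import all_classical all_reals all_analysis.

Set Implicit Arguments.
Unset Strict Implicit.
Unset Printing Implicit Defensive.

Import Order.TTheory GRing.Theory Num.Theory.
Import numFieldNormedType.Exports.

Local Open Scope classical_set_scope.

Record sgraph := SGraph {
  vertex :> finType;
  adj : rel vertex;
  adj_sym : symmetric adj;
  adj_irr : irreflexive adj }.

Definition isomorphic (G H : sgraph) : Prop :=
  exists f : G -> H, bijective f /\ forall x y, adj (f x) (f y) = adj x y.

(* [H] is isomorphic to a (not necessarily induced) subgraph of [G]. *)
Definition contains (G H : sgraph) : Prop :=
  exists f : H -> G, injective f /\ forall x y, adj x y -> adj (f x) (f y).

Definition nbrs (G : sgraph) (x : G) : {set G} := [set y | adj x y]%SET.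

Definition max_degree (G : sgraph) : nat := \max_(x : G) #|nbrs x|.

Definition common_nbrs (G : sgraph) (u : seq G) : {set G} :=
  [set x | all (fun y => adj x y) u]%SET.

Definition A (n : nat) (G : sgraph) : set nat :=
  [set a | exists u : n.-tuple G, uniq u /\ #|common_nbrs u| = a].

Section EmptyGraph.
Variable n : nat.
Definition empty_adj : rel 'I_n := fun _ _ => false.
Lemma empty_adj_sym : symmetric empty_adj. Proof. by []. Qed.
Lemma empty_adj_irr : irreflexive empty_adj. Proof. by []. Qed.
Definition empty_graph := SGraph empty_adj_sym empty_adj_irr.
End EmptyGraph.

Section CompleteGraph.
Variable n : nat.
Definition complete_adj : rel 'I_n := fun i j => i != j.
Lemma complete_adj_sym : symmetric complete_adj.
Proof. by move=> i j; rewrite /complete_adj eq_sym. Qed.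
Lemma complete_adj_irr : irreflexive complete_adj.
Proof. by move=> i; rewrite /complete_adj eqxx. Qed.
Definition complete_graph := SGraph complete_adj_sym complete_adj_irr.
End CompleteGraph.

Section PathGraph.
Variable n : nat.
Definition path_adj : rel 'I_n :=
  fun i j => (i.+1 == j :> nat) || (j.+1 == i :> nat).
Lemma path_adj_sym : symmetric path_adj.
Proof. by move=> i j; rewrite /path_adj orbC. Qed.
Lemma path_adj_irr : irreflexive path_adj.
Proof. by move=> i; rewrite /path_adj orbb eqn_leq ltnn. Qed.
Definition path_graph := SGraph path_adj_sym path_adj_irr.
End PathGraph.

(* The cycle on [n] vertices when [3 <= n]. *)
Section CycleGraph.
Variable n : nat.
Definition cycle_adj : rel 'I_n :=
  fun i j => (i != j) && ((i.+1 %% n == j) || (j.+1 %% n == i)).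
Lemma cycle_adj_sym : symmetric cycle_adj.
Proof. by move=> i j; rewrite /cycle_adj eq_sym orbC. Qed.
Lemma cycle_adj_irr : irreflexive cycle_adj.
Proof. by move=> i; rewrite /cycle_adj eqxx. Qed.
Definition cycle_graph := SGraph cycle_adj_sym cycle_adj_irr.
End CycleGraph.

Section Join.
Variables G H : sgraph.
Definition join_adj : rel (G + H)%type := fun s t =>
  match s, t with
  | inl x, inl y => adj x y
  | inr x, inr y => adj x y
  | _, _ => true
  end.
Lemma join_adj_sym : symmetric join_adj.
Proof. by move=> [x|x] [y|y] //=; apply: adj_sym. Qed.
Lemma join_adj_irr : irreflexive join_adj.
Proof. by move=> [x|x] /=; apply: adj_irr. Qed.
Definition join := SGraph join_adj_sym join_adj_irr.
End Join.

(* [K_4] on the vertices 0, 1, 2, 3, together with one new vertex for each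
   entry of [N], adjacent exactly to the vertices of [K_4] listed there. *)
Section StackedK4.
Variable N : seq (seq nat).
Definition stackedK4_adj : rel ('I_4 + 'I_(size N))%type := fun s t =>
  match s, t with
  | inl i, inl j => i != j
  | inl i, inr k => (i : nat) \in nth [::] N k
  | inr k, inl i => (i : nat) \in nth [::] N k
  | inr _, inr _ => false
  end.
Lemma stackedK4_adj_sym : symmetric stackedK4_adj.
Proof. by move=> [x|x] [y|y] //=; rewrite eq_sym. Qed.
Lemma stackedK4_adj_irr : irreflexive stackedK4_adj.
Proof. by move=> [x|x] //=; rewrite eqxx. Qed.
Definition stackedK4 := SGraph stackedK4_adj_sym stackedK4_adj_irr.
End StackedK4.

Definition K4 : sgraph := complete_graph 4.
Definition K2l (l : nat) : sgraph := join (empty_graph 2) (empty_graph l).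
Definition T (m : nat) : sgraph := join (path_graph m) (complete_graph 2).
Definition B (l : nat) : sgraph := join (cycle_graph l) (empty_graph 2).
Definition B' (l : nat) : sgraph := join (path_graph l) (empty_graph 2).
Definition S5 : sgraph :=
  stackedK4 [:: [:: 0; 1; 2]; [:: 0; 1; 3]; [:: 0; 2; 3]]%N.
Definition S7 : sgraph :=
  stackedK4 [:: [:: 0; 1; 2]; [:: 0; 1; 3]; [:: 0; 2; 3]; [:: 1; 2; 3]]%N.

(* The cap on [l] is harmless: [contains_K2l_bound] shows that a graph [G]
   cannot contain a [K_{2,l}] with [l > #|G|]. *)
Definition L (G : sgraph) : nat :=
  \max_(l < #|G|.+1 | `[< contains G (K2l l) >]) l.

Lemma contains_K2l_bound (G : sgraph) (l : nat) :
  contains G (K2l l) -> (l + 2 <= #|G|)%N.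
Proof.
move=> [f [f_inj _]]; have := leq_card f f_inj.
by rewrite card_sum !card_ord addnC.
Qed.

(* [G] has more than 3 vertices, and deleting fewer than 3 vertices never
   disconnects it. *)
Definition three_connected (G : sgraph) : Prop :=
  (3 < #|G|)%N /\
  forall X : {set G}, (#|X| < 3)%N ->
  forall x y : G, x \notin X -> y \notin X ->
    connect [rel a b | [&& a \notin X, b \notin X & adj a b]] x y.

Section Planarity.
Variable R : realType.
Local Open Scope ring_scope.

Definition arc_between (p q : R * R) (C : set (R * R)) : Prop :=
  exists g : R -> R * R,
    [/\ {within `[0, 1], continuous g},
        {in `[0, 1] &, injective g},
        g 0 = p, g 1 = q & C = g @` `[0, 1]].

(* A drawing of [G] without crossings in the Euclidean plane [R * R]: the edge
   joining [x] and [y] is drawn as the simple arc [edge [set x; y]], which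
   includes its two end points. *)
Definition planar (G : sgraph) : Prop :=
  exists (pos : G -> R * R) (edge : {set G} -> set (R * R)),
  [/\ injective pos,
      forall x y : G, adj x y ->
        arc_between (pos x) (pos y) (edge [set x; y]%SET),
      forall x y z : G, adj x y ->
        edge [set x; y]%SET (pos z) -> z = x \/ z = y
    & forall x y x' y' : G, adj x y -> adj x' y' ->
        [set x; y]%SET != [set x'; y']%SET ->
        edge [set x; y]%SET `&` edge [set x'; y']%SET `<=` range pos].

Definition polyhedron (G : sgraph) : Prop := planar G /\ three_connected G.

End Planarity.

Definition exceptional (G : sgraph) : Prop :=
  (exists m, (3 <= m)%N /\ isomorphic G (T m)) \/
  (exists l, (5 <= l)%N /\ (isomorphic G (B l) \/ isomorphic G (B' l))) \/
  isomorphic G K4 \/ isomorphic G (B 4) \/ isomorphic G S5 \/ isomorphic G S7.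

(* Main.v *)
Require Import Defs.
From mathcomp Require Import all_boot all_order all_algebra.
From mathcomp Require Import all_classical all_reals all_analysis.
From mathcomp Require Import zify lra.

(** Planarity is used only through the absence of [K_{3,3}] and [K_5] minors,
    which is obtained without the Jordan curve theorem. Replace every edge of
    the minor by a sequence of points whose steps are much smaller than the
    distance between independent edges. For independent edges [e = ij] and
    [f = kl], the differences [q - p] with [p] on [e] and [q] on [f] form a
    discrete rectangle that stays away from the origin, so its boundary meets
    the upward ray from the origin an even number of times. In the sum of these
    relations over all pairs of independent edges of [K_{3,3}] or [K_5] all
    unknowns cancel, and [1 = 0] modulo 2 remains.

    Let [n >= 3]. Then [A_n(G)] is contained in [{0, 1, 2}] because [G] has no
    [K_{3,3}], and contains [2] exactly if [n <= L].

    Suppose that every three vertices have a common neighbour. Then any two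
    vertices have two adjacent common neighbours, so every edge lies in a [K_4].
    Each component of [G - K_4] is attached to exactly three vertices of the
    [K_4], and distinct components to distinct triples. Three or four components
    give [S_5] or [S_7], and two give [T_m]. If there is never more than one,
    then every [K_4] contains a vertex of degree 3, called a corner below; either
    two corners have the same neighbours, which gives [T_m], or the neighbours
    of three corners contain a [K_4] without corner.

    Suppose that [n <= L] and that no [n] vertices have exactly one common
    neighbour. Then a vertex [v] of maximum degree has a twin [w] with
    [N(v) = N(w)]; by 3-connectedness and the absence of [K_{3,3}] minors there
    are no vertices outside [N(v)] and [{v, w}], and [N(v)] induces a path or a
    cycle, so [G] is [B_l] or [B'_l]. When [n = 3] the twin is found after [K_4]
    has been excluded by a descent on the size of a component of [G - K_4]. *)

Set Implicit Arguments.
Unset Strict Implicit.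
Unset Printing Implicit Defensive.

Import Order.TTheory GRing.Theory Num.Theory.
Import numFieldNormedType.Exports.

(** * Parity of the crossings of two sequences of points with a vertical ray *)

Section CrossingParity.
Variable R : realDomainType.
Local Open Scope ring_scope.
Implicit Types p q r : R * R.

Definition close_by (e : R) : rel (R * R) :=
  fun p q => (`|p.1 - q.1| < e) && (`|p.2 - q.2| < e).

Definition far (d : R) p := (d <= `|p.1|) || (d <= `|p.2|).

(* The second disjunct makes [halfplane (- p)] the negation of [halfplane p] for
   every [p != 0]. *)
Definition halfplane p := (0 < p.1) || (p.1 == 0) && (0 < p.2).

(* Whether the step from [p] to [q] meets the upward ray from the origin; this is
   meaningful only for a step much shorter than the distance to the origin. *)
Definition ray_cross p q := (halfplane p (+) halfplane q) && (0 < p.2).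

Lemma halfplane_opp p : p != 0 -> halfplane (- p) = ~~ halfplane p.
Proof.
case: p => x y; rewrite /halfplane /= !oppr_gt0 oppr_eq0.
rewrite -[_ != _]/(~~ ((x == 0) && (y == 0))).
by case: (ltgtP x 0) => //= _; case: (ltgtP y 0).
Qed.

Lemma far_neq0 d p : 0 < d -> far d p -> p != 0.
Proof.
move=> d0; apply: contraTneq => ->.
by rewrite /far /= normr0 orbb leNgt d0.
Qed.

Lemma far_opp d p : far d (- p) = far d p.
Proof. by rewrite /far /= !normrN. Qed.

(** A short step between the half-planes forces [|p.1| < 2 * e], so [far] makes [|p.2|] at least
    [8 * e], and no point within [2 * e] of [p] can change the sign of the second coordinate. *)
Lemma cross_sign e p q r : far (8 * e) p -> close_by (2 * e) p q ->
  close_by (2 * e) p r -> halfplane p != halfplane q ->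
  (0 < r.2) = (0 < p.2) /\ p.2 != 0.
Proof.
move: p q r => [x y] [x' y'] [x'' y'']; rewrite /far /close_by /halfplane /=.
move=> F /andP[c1 c2] /andP[c3 c4] H.
have E : `|x| < 2 * e.
  move: c1 H; case: (ltgtP x 0) => hx; case: (ltgtP x' 0) => hx' //=;
    rewrite ?ltr_norml /=; do ?[by move=> ? /eqP]; by lra.
have {}F : 8 * e <= `|y|.
  by case/orP: F => // F; move: E F (normr_ge0 x); lra.
move: c4 F; case: (ltgtP y 0) => hy; rewrite ?ltr_norml /=.
- move=> ?; rewrite ltr0_norm // => ?; split=> //; apply/negP; lra.
- move=> ?; rewrite gtr0_norm // => ?; split=> //; apply/idP; lra.
- by rewrite hy normr0 => ? ?; move: E (normr_ge0 x); lra.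
Qed.

(** Negation exchanges the upward and the downward ray, and a step between the half-planes meets
    exactly one of them. *)
Lemma ray_cross_opp e p q : 0 < e -> far (8 * e) p -> far (8 * e) q ->
  close_by (2 * e) p q ->
  ray_cross (- p) (- q) = ray_cross p q (+) (halfplane p (+) halfplane q).
Proof.
move=> e0 fp fq cpq; have d0 : 0 < 8 * e by rewrite mulr_gt0.
have cpp : close_by (2 * e) p p by rewrite /close_by !subrr normr0 mulr_gt0.
rewrite /ray_cross !halfplane_opp ?(far_neq0 d0) // addbN addNb negbK.
case: (eqVneq (halfplane p) (halfplane q)) => [->|ne]; first by rewrite addbb.
have [_ h] := cross_sign fp cpq cpp ne.
have -> : halfplane p (+) halfplane q = true.
  by move: ne; case: halfplane; case: halfplane.
by rewrite /= oppr_gt0 addbT; case: ltgtP h.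
Qed.

(** If all four points lie in one half-plane, nothing is crossed. Otherwise [cross_sign] gives all
    four second coordinates the same sign, and a closed tour changes half-plane an even number of
    times. *)
Lemma ray_cross_square e p q r t :
  (forall x y, x \in [:: p; q; r; t] -> y \in [:: p; q; r; t] ->
     close_by (2 * e) x y) ->
  (forall x, x \in [:: p; q; r; t] -> far (8 * e) x) ->
  ray_cross p q (+) ray_cross q r (+) ray_cross t r (+) ray_cross p t = false.
Proof.
move=> C F.
have S x y z : x \in [:: p; q; r; t] -> y \in [:: p; q; r; t] ->
    z \in [:: p; q; r; t] -> halfplane x != halfplane y ->
    (0 < z.2) = (0 < x.2).
  move=> hx hy hz ne.
  by case: (cross_sign (F x hx) (C x y hx hy) (C x z hx hz) ne).
have ip : p \in [:: p; q; r; t] by rewrite !inE eqxx.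
have iq : q \in [:: p; q; r; t] by rewrite !inE eqxx ?orbT.
have ir : r \in [:: p; q; r; t] by rewrite !inE eqxx ?orbT.
have it : t \in [:: p; q; r; t] by rewrite !inE eqxx ?orbT.
have pq := S p q _ ip iq; have pr := S p r _ ip ir; have pt := S p t _ ip it.
rewrite /ray_cross.
case: (eqVneq (halfplane p) (halfplane q)) => [eq_pq|ne].
  case: (eqVneq (halfplane p) (halfplane r)) => [eq_pr|ne].
    case: (eqVneq (halfplane p) (halfplane t)) => [eq_pt|ne].
      by rewrite -eq_pq -eq_pr -eq_pt !addbb.
    rewrite (pt q) // (pt t) //; do 4!case: halfplane => //=; by case: (0 < _).
  rewrite (pr q) // (pr t) //; do 4!case: halfplane => //=; by case: (0 < _).
rewrite (pq q) // (pq t) //; do 4!case: halfplane => //=; by case: (0 < _).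
Qed.

Fixpoint crossings p (s : seq (R * R)) :=
  if s is q :: s' then ray_cross p q (+) crossings q s' else false.

(* The path [y :: ys] against the upward ray from [x]; in [crossings_below], the
   path [x :: xs] against the downward ray from [y]. *)
Definition crossings_above x y (ys : seq (R * R)) :=
  crossings (y - x) [seq z - x | z <- ys].

Definition crossings_below x (xs : seq (R * R)) y :=
  crossings (y - x) [seq y - z | z <- xs].

Lemma closeB e x y z t : close_by e x y -> close_by e z t ->
  close_by (2 * e) (x - z) (y - t).
Proof.
rewrite /close_by /= => /andP[] ? ? /andP[] ? ?.
have H (a b c d : R) : `|a - b| < e -> `|c - d| < e ->
    `|a - c - (b - d)| < 2 * e.
  by rewrite !ltr_norml; lra.
by rewrite !H.
Qed.

Lemma close_by_refl e x : 0 < e -> close_by e x x.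
Proof. by move=> e0; rewrite /close_by !subrr normr0 e0. Qed.

Lemma close_by_sym e : symmetric (close_by e).
Proof. by move=> p q; rewrite /close_by distrC [`|p.2 - _|]distrC. Qed.

(** Sum of [ray_cross_opp] along the path; the half-plane terms telescope to the two ends. *)
Lemma crossings_opp e p s : 0 < e -> path (close_by (2 * e)) p s ->
  all (far (8 * e)) (p :: s) ->
  crossings (- p) [seq - q | q <- s] =
    crossings p s (+) (halfplane p (+) halfplane (last p s)).
Proof.
move=> e0; elim: s p => [p|q s IH p] /=; first by rewrite addbb.
case/andP=> pq sq /and3P[fp fq fs].
rewrite (ray_cross_opp e0 fp fq pq) IH //= ?fq //.
by move: (ray_cross p q) (crossings q s) (halfplane p) (halfplane q)
  (halfplane (last _ _)) => [] [] [] [] [].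
Qed.

Lemma crossings_belowE e x xs y : 0 < e -> path (close_by e) x xs ->
  (forall z, z \in x :: xs -> far (8 * e) (z - y)) ->
  crossings_below x xs y = crossings_above y x xs (+)
    (halfplane (x - y) (+) halfplane (last x xs - y)).
Proof.
move=> e0 pxs F; rewrite /crossings_above -(last_map (fun z => z - y)).
rewrite -(@crossings_opp e) //.
- rewrite /crossings_below opprB -map_comp; congr crossings.
  by apply: eq_map => z /=; rewrite opprB.
- apply: (homo_path (f := fun z => z - y)) pxs => a b ab.
  by apply: closeB => //; apply: close_by_refl.
- apply/allP => z; rewrite -(map_cons (fun z => z - y)).
  by case/mapP=> t /F ft ->.
Qed.

Definition all_far d (xs ys : seq (R * R)) :=
  forall x y, x \in xs -> y \in ys -> far d (y - x).

(** The differences with [x] and with [x'] form a strip of small squares; [ray_cross_square] is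
    summed over them and the inner rungs cancel. *)
Lemma crossings_strip e x x' y ys : 0 < e -> close_by e x x' ->
  path (close_by e) y ys -> all_far (8 * e) [:: x; x'] (y :: ys) ->
  crossings_above x y ys (+) crossings_above x' y ys (+)
    (ray_cross (y - x) (y - x') (+)
     ray_cross (last y ys - x) (last y ys - x')) = false.
Proof.
move=> e0 xx'; rewrite /crossings_above.
elim: ys y => [y|y' ys IH y] /=; first by rewrite addbb.
case/andP=> yy' sy F.
have /= {}IH := IH y' sy (fun a b ha hb => F a b ha (@mem_behead _ (y :: _) b hb)).
have Q : ray_cross (y - x) (y' - x) (+) ray_cross (y' - x) (y' - x') (+)
   ray_cross (y - x') (y' - x') (+) ray_cross (y - x) (y - x') = false.
  have xx := close_by_refl x e0; have x'x' := close_by_refl x' e0.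
  have yy := close_by_refl y e0; have y'y' := close_by_refl y' e0.
  have x'x : close_by e x' x by rewrite close_by_sym.
  have y'y : close_by e y' y by rewrite close_by_sym.
  apply: (@ray_cross_square e) => [a b|a]; rewrite !inE.
  - by case/or4P=> /eqP-> /or4P[]/eqP->; apply: closeB.
  - by case/or4P=> /eqP->; apply: F; rewrite !inE eqxx ?orbT.
have add a b c d f g h : a (+) b (+) (c (+) h) = false ->
    d (+) c (+) f (+) g = false -> d (+) a (+) (f (+) b) (+) (g (+) h) = false.
  by case: a b c d f g h => [] [] [] [] [] [] [].
exact: add IH Q.
Qed.

(** Summing the strips leaves the four sides of the rectangle of differences, which therefore meet
    the ray an even number of times. *)
Lemma crossings_grid e x xs y ys : 0 < e -> path (close_by e) x xs ->
  path (close_by e) y ys -> all_far (8 * e) (x :: xs) (y :: ys) ->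
  crossings_above x y ys (+) crossings_above (last x xs) y ys (+)
    (crossings_below x xs y (+) crossings_below x xs (last y ys)) = false.
Proof.
move=> e0; rewrite /crossings_below.
elim: xs x => [x _ _ _|x' xs IH x] /=; first by rewrite addbb.
case/andP=> xx' sx sy F.
have {}IH := IH x' sx sy (fun a b ha hb => F a b (@mem_behead _ (x :: _) a ha) hb).
have := crossings_strip e0 xx' sy.
have /[swap]/[apply] : all_far (8 * e) [:: x; x'] (y :: ys).
  by move=> a b; rewrite !inE => /orP[]/eqP-> hb; apply: F => //; rewrite !inE eqxx ?orbT.
have add a b c d f g h : a (+) b (+) (c (+) d) = false ->
    f (+) a (+) (g (+) h) = false ->
    f (+) b (+) (g (+) c (+) (h (+) d)) = false.
  by case: a b c d f g h => [] [] [] [] [] [] [].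
exact: add IH.
Qed.

(** In the grid relation the two sides traced by [xs] are measured by downward rays; turning them
    into upward ones adds the half-plane terms at the four corners. Both paths are then on the same
    footing, so that terms of different pairs can cancel. *)
Lemma crossings_pair e x xs y ys : 0 < e -> path (close_by e) x xs ->
  path (close_by e) y ys -> all_far (8 * e) (x :: xs) (y :: ys) ->
  let x' := last x xs in let y' := last y ys in
  crossings_above x y ys (+) crossings_above x' y ys (+)
  crossings_above y x xs (+) crossings_above y' x xs (+)
  (halfplane (x - y) (+) halfplane (x' - y) (+)
   halfplane (x - y') (+) halfplane (x' - y')) = false.
Proof.
move=> e0 sx sy F x' y'; have := crossings_grid e0 sx sy F.
have F' z t : t \in y :: ys -> z \in x :: xs -> far (8 * e) (z - t).
  by move=> ? ?; rewrite -far_opp opprB; apply: F.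
rewrite (crossings_belowE e0) //; last by move=> z hz; apply: F' => //; rewrite inE eqxx.
rewrite (crossings_belowE e0) //; last by move=> z hz; apply: F' => //; exact: mem_last.
rewrite -/x' -/y'.
have add a b c d f g h i : a (+) b (+) (c (+) (f (+) g) (+) (d (+) (h (+) i)))
    = false -> a (+) b (+) c (+) d (+) (f (+) g (+) h (+) i) = false.
  by case: a b c d f g h i => [] [] [] [] [] [] [] [].
exact: add.
Qed.

End CrossingParity.

(** * Discretisation of a plane drawing *)

Section Arcs.
Variable R : realType.
Local Open Scope classical_set_scope.
Local Open Scope ring_scope.
Implicit Types (p q : R * R) (C D : set (R * R)).

Lemma arc_compact p q C : arc_between p q C -> compact C.
Proof.
case=> g [gc _ _ _ ->]; apply: continuous_compact => //.
exact: segment_compact.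
Qed.

Lemma arc_connected p q C : arc_between p q C -> connected C.
Proof.
case=> g [gc _ _ _ ->]; apply: connected_continuous_connected => //.
exact: segment_connected.
Qed.

Lemma arc_ends p q C : arc_between p q C -> C p /\ C q.
Proof.
by case=> g [_ _ <- <- ->]; split; [exists 0|exists 1] => //=;
   rewrite in_itv /= ?lexx ?ler01.
Qed.

(** The norm of the difference attains a positive minimum on the compact product of [C] and [D];
    since the norm on pairs is the maximum norm, this is [far]. *)
Lemma compact_far C D : compact C -> compact D -> C `&` D = set0 ->
  exists2 d : R, 0 < d & forall p q, C p -> D q -> far d (q - p).
Proof.
move=> cC cD CD0.
have [[[p0 q0] [Cp0 Dq0]]|/set0P/negP/negPn/eqP CD] :=
    pselect (C `*` D !=set0); last first.
  exists 1 => // p q Cp Dq.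
  by have : (C `*` D) (p, q); [split | rewrite CD].
pose f (z : (R * R) * (R * R)) : R := `|z.2 - z.1|.
have fc : {within C `*` D, continuous f}.
  apply: continuous_subspaceT => z; apply: cvg_norm.
  by apply: cvgB; [exact: cvg_snd | exact: cvg_fst].
have CDn : C `*` D !=set0 by exists (p0, q0).
have [[p1 q1] + mn] := compact_EVT_min CDn (compact_setX cC cD) fc.
rewrite inE => -[/= Cp1 Dq1].
exists (f (p1, q1)).
  rewrite normr_gt0 subr_eq0 /=; apply/negP => /eqP e.
  by have : (C `&` D) p1; [split=> //; rewrite -e | rewrite CD0].
move=> p q Cp Dq; have := mn (p, q); rewrite inE => /(_ (conj Cp Dq)).
by rewrite {2}/f /= prod_normE /= le_max.
Qed.

(** The points of [C] reachable from [p] by chains inside [C] form a nonempty set that is both open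
    and closed in [C]. *)
Lemma connected_chain (e : R) p q C : 0 < e -> connected C -> C p -> C q ->
  exists s, [/\ path (close_by e) p s, last p s = q
              & forall z, z \in p :: s -> C z].
Proof.
move=> e0 Cc Cp Cq.
pose B := [set q | exists s, [/\ path (close_by e) p s, last p s = q
              & forall z, z \in p :: s -> C z]].
have oball (z : R * R) : open (ball z e) by apply: ball_open.
have ballE (z y : R * R) : ball z e y = close_by e z y.
  apply/propext; split; first by case=> h1 h2; apply/andP.
  by case/andP.
suff : B = C by move=> BC; rewrite -BC in Cq.
have BC : B `<=` C by move=> z [s [_ <- h]]; apply/h/mem_last.
have step z y : B z -> C y -> close_by e z y -> B y.
  move=> [s [sp sl sC]] Cy zy; exists (rcons s y); split.
  - by rewrite rcons_path sp sl.
  - by rewrite last_rcons.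
  - move=> t; rewrite -rcons_cons mem_rcons inE => /orP[/eqP->|] //.
    exact: sC.
apply: Cc.
- by exists p; exists [::]; split=> // z; rewrite inE => /eqP->.
- exists (\bigcup_(z in B) ball z e); first exact: bigcup_open.
  apply/seteqP; split=> [z Bz|y [Cy [z Bz]]].
    by split; [apply: BC | exists z => //; apply: ballxx].
  by rewrite ballE; apply: step.
- exists (~` \bigcup_(z in C `\` B) ball z e).
    by apply: open_closedC; apply: bigcup_open.
  apply/seteqP; split=> [y By|y [Cy ny]].
    split; first exact: BC.
    move=> [z [Cz nBz]]; rewrite ballE close_by_sym => zy; apply: nBz.
    exact: step By Cz zy.
  by apply: contrapT => nBy; apply: ny; exists y => //; apply: ballxx.
Qed.

End Arcs.

Lemma uniform_far (R : realType) (I : finType) (P : I -> R -> Prop) :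
  (forall i, exists2 d, (0 < d)%R & P i d) ->
  (forall i d d', (d' <= d)%R -> P i d -> P i d') ->
  exists2 d, (0 < d)%R & forall i, P i d.
Proof.
move=> ex mono.
suff [d d0 H] : exists2 d, (0 < d)%R & forall i, i \in enum I -> P i d.
  by exists d => // i; apply: H; rewrite mem_enum.
elim: (enum I) => [|i s [d d0 H]]; first by exists 1%R.
have [d' d'0 H'] := ex i; exists (Num.min d d').
  by rewrite lt_min d0 d'0.
move=> j; rewrite inE => /orP[/eqP->|/H jd]; [apply: mono H' | apply: mono jd].
- by rewrite ge_min lexx orbT.
- by rewrite ge_min lexx.
Qed.

Section Drawing.
Variables (R : realType) (G : sgraph).
Local Open Scope ring_scope.

Lemma planar_chains : planar R G ->
  exists (pos : G -> R * R) (e : R) (ch : G -> G -> seq (R * R)),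
  [/\ injective pos, 0 < e,
      forall a b, adj a b ->
        path (close_by e) (pos a) (ch a b) /\ last (pos a) (ch a b) = pos b
    & forall a b c d, adj a b -> adj c d ->
        [disjoint [set a; b]%SET & [set c; d]%SET] ->
        all_far (8 * e) (pos a :: ch a b) (pos c :: ch c d)].
Proof.
move=> [pos [edge [pinj arcs vtx cross]]].
pose P (t : (G * G) * (G * G)) (d : R) :=
  adj t.1.1 t.1.2 -> adj t.2.1 t.2.2 ->
  [disjoint [set t.1.1; t.1.2]%SET & [set t.2.1; t.2.2]%SET] ->
  forall p q, edge [set t.1.1; t.1.2]%SET p -> edge [set t.2.1; t.2.2]%SET q ->
  far d (q - p).
have [d d0 Pd] : exists2 d, 0 < d & forall t, P t d.
  apply: uniform_far; last first.
    move=> t d d' d'd H h1 h2 h3 p q hp hq.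
    by case/orP: (H h1 h2 h3 p q hp hq) => h; rewrite /far (le_trans d'd h) ?orbT.
  move=> [[a b] [c d]]; rewrite /P /=.
  have [ab|?] := boolP (adj a b); last by exists 1.
  have [cd|?] := boolP (adj c d); last by exists 1.
  have [dj|?] := boolP [disjoint [set a; b]%SET & [set c; d]%SET]; last by exists 1.
  (* By [cross] a shared point would be a vertex, and by [vtx] a vertex on both arcs is a common end
     of the two edges. *)
  have disj : (edge [set a; b]%SET `&` edge [set c; d]%SET = set0)%classic.
    have ne : [set a; b]%SET != [set c; d]%SET.
      apply: contraTneq dj => ->; apply/pred0Pn; exists c.
      by rewrite !inE eqxx.
    rewrite -subset0 => z zz; have [x _ xz] := cross _ _ _ _ ab cd ne z zz.
    case: zz; rewrite -xz => /(vtx _ _ _ ab) h1 /(vtx _ _ _ cd) h2.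
    have xab : x \in [set a; b]%SET by rewrite !inE; case: h1 => ->; rewrite eqxx ?orbT.
    by have := disjointFr dj xab; rewrite !inE; case: h2 => ->; rewrite eqxx ?orbT.
  have [d' d'0 H] := compact_far (arc_compact (arcs _ _ ab))
    (arc_compact (arcs _ _ cd)) disj.
  by exists d'.
(* Differences of two chains move by less than [2 * e] per step and stay at distance [8 * e] from
   the origin, as the parity lemmas require. *)
pose e := d / 8; have e0 : 0 < e by rewrite divr_gt0.
pose Q (t : G * G) (s : seq (R * R)) := adj t.1 t.2 ->
  [/\ path (close_by e) (pos t.1) s, last (pos t.1) s = pos t.2
    & forall z, z \in pos t.1 :: s -> edge [set t.1; t.2]%SET z].
have /choice[ch Qch] : forall t, exists s, Q t s.
  move=> [a b]; rewrite /Q /=; have [ab|?] := boolP (adj a b); last by exists [::].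
  have arc := arcs _ _ ab; have [h1 h2] := arc_ends arc.
  by have [s hs] := connected_chain e0 (arc_connected arc) h1 h2; exists s.
exists pos, e, (fun a b => ch (a, b)); split=> // [a b ab|a b c c' ab cc dj p q hp hq].
  by have [] := Qch (a, b) ab.
have -> : 8 * e = d by rewrite /e; lra.
have [_ _ h1] := Qch (a, b) ab; have [_ _ h2] := Qch (c, c') cc.
by apply: (Pd ((a, b), (c, c'))) => //; [apply: h1 | apply: h2].
Qed.

End Drawing.

(** * Minors of planar graphs *)

Section Connectivity.
Variable G : sgraph.
Implicit Types (C D : {set G}) (x y : G).

Definition adj_in C : rel G := [rel a b | [&& a \in C, b \in C & adj a b]].

Definition connected_in C :=
  forall x y, x \in C -> y \in C -> connect (adj_in C) x y.

Definition touch C D := exists x y, [/\ x \in C, y \in D & adj x y].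

Lemma connected_in1 x : connected_in [set x].
Proof. by move=> y z; rewrite !inE => /eqP-> /eqP->. Qed.

Lemma connect_adj_inS C D x y : C \subset D ->
  connect (adj_in C) x y -> connect (adj_in D) x y.
Proof.
move=> /fintype.subsetP CD; apply: connect_sub => a b /and3P[aC bC ab].
by apply: connect1; rewrite /adj_in /= !CD.
Qed.

Lemma touch_walk C D x y : connected_in C -> connected_in D -> touch C D ->
  x \in C -> y \in D -> connect (adj_in (C :|: D)) x y.
Proof.
move=> cC cD [a [b [aC bD ab]]] xC yD.
apply: connect_trans (connect_adj_inS (finset.subsetUl _ _) (cC x a xC aC)) _.
apply: connect_trans (connect_adj_inS (finset.subsetUr _ _) (cD b y bD yD)).
by apply: connect1; rewrite /adj_in /= !inE aC bD ab orbT.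
Qed.

End Connectivity.

(* The terms of the relation for the edges [e] and [f] of the minor. The atom
   [[:: i; k; l]] is the parity of the crossings of the edge [kl] with the upward
   ray from the vertex [i], the atom [[:: i; j]] tells whether the difference of
   the vertices [i] and [j] lies in [halfplane], and [[::]] is the constant 1. *)
Definition parity_terms (e f : nat * nat) : seq (seq nat) :=
  let side i j := if (i < j)%N then [:: [:: i; j]] else [:: [::]; [:: j; i]] in
  [:: [:: e.1; f.1; f.2]; [:: e.2; f.1; f.2]; [:: f.1; e.1; e.2];
      [:: f.2; e.1; e.2]]
  ++ side e.1 f.1 ++ side e.2 f.1 ++ side e.1 f.2 ++ side e.2 f.2.

Definition independent (e f : nat * nat) :=
  [&& e.1 != f.1, e.1 != f.2, e.2 != f.1 & e.2 != f.2]%N.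

(** Independent edges have different first ends, so [e.1 < f.1] selects one order of each pair. *)
Definition parity_system (es : seq (nat * nat)) : seq (seq nat) :=
  flatten [seq parity_terms e f | e <- es, f <- [seq f <- es |
    independent e f && (e.1 < f.1)%N]].

(** Reduction of a formal sum modulo 2: a term that is already present removes its copy instead of
    being added. *)
Definition cancel_pairs (s : seq (seq nat)) : seq (seq nat) :=
  foldr (fun a acc => if a \in acc then rem a acc else a :: acc) [::] s.

Definition xor_all (v : seq nat -> bool) (s : seq (seq nat)) : bool :=
  foldr (fun a b => v a (+) b) false s.

Lemma xor_all_cat v s t : xor_all v (s ++ t) = xor_all v s (+) xor_all v t.
Proof. by elim: s => //= a s ->; rewrite addbA. Qed.

Lemma xor_all_rem v a s : a \in s -> xor_all v (rem a s) = v a (+) xor_all v s.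
Proof.
elim: s => //= b s IH; rewrite inE eq_sym; case: eqVneq => /= [->|_ /IH->].
  by rewrite addbA addbb.
by rewrite addbCA.
Qed.

Lemma xor_all_cancel v s : xor_all v (cancel_pairs s) = xor_all v s.
Proof.
elim: s => //= a s <-; case: ifP => //= h.
by rewrite xor_all_rem.
Qed.

(** Unfolds a claim over a concrete list into a conjunction, one conjunct per edge of a minor. *)
Lemma all_prop (T : eqType) (P : T -> Prop) (s : seq T) :
  foldr (fun x Q => P x /\ Q) True s -> forall x, x \in s -> P x.
Proof.
by elim: s => //= a s IH [Pa /IH Ps] x; rewrite inE => /orP[/eqP->|/Ps].
Qed.

Section Minors.
Variables (R : realType) (G : sgraph).
Hypothesis planarG : planar R G.

(** Chains of edges are concatenated along a walk inside [C]. An edge inside [C] and an edge inside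
    a disjoint [D] are independent, so their chains are far apart. *)
Lemma planar_walks :
  exists (pos : G -> R * R) (e : R), [/\ injective pos, (0 < e)%R &
    exists w : {set G} -> G -> G -> seq (R * R),
    (forall C x y, x != y -> connect (adj_in C) x y ->
      path (close_by e) (pos x) (w C x y) /\
      last (pos x) (w C x y) = pos y) /\
    (forall (C D : {set G}) x y z t, [disjoint C & D] -> x != y -> z != t ->
      connect (adj_in C) x y -> connect (adj_in D) z t ->
      all_far (8 * e)%R (pos x :: w C x y) (pos z :: w D z t))].
Proof.
have [pos [e [ch [pinj e0 Hch Hfar]]]] := planar_chains planarG.
exists pos, e; split=> //.
pose Q (t : {set G} * (G * G)) (s : seq (R * R)) :=
  t.2.1 != t.2.2 -> connect (adj_in t.1) t.2.1 t.2.2 ->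
  [/\ path (close_by e) (pos t.2.1) s, last (pos t.2.1) s = pos t.2.2 &
    forall z, z \in pos t.2.1 :: s -> exists a b, [/\ a \in t.1, b \in t.1,
      adj a b & z \in pos a :: ch a b]].
have /choice[w Hw] : forall t, exists s, Q t s.
  move=> [C [x y]]; rewrite /Q /=.
  have [->|xy] := eqVneq x y; first by exists [::].
  have [/connectP[p]|?] := boolP (connect (adj_in C) x y); last by exists [::].
  elim: p x xy => [x xy _ e'|z p IH x xy]; first by rewrite e' eqxx in xy.
  rewrite [path _ _ _]/= => /andP[/and3P[xC zC xz] zp] yl.
  have [h1 h2] := Hch _ _ xz.
  have hx t : t \in pos x :: ch x z -> exists a b,
    [/\ a \in C, b \in C, adj a b & t \in pos a :: ch a b] by exists x, z.
  have [zy|zy] := eqVneq z y.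
    by exists (ch x z) => _ _; rewrite -zy.
  have [s Hs] := IH z zy zp yl.
  have [s1 s2 s3] := Hs isT isT.
  exists (ch x z ++ s) => _ _; split.
  - by rewrite cat_path h1 h2.
  - by rewrite last_cat h2.
  - move=> t; rewrite -cat_cons mem_cat => /orP[/hx //|ts].
    by apply: s3; rewrite inE ts orbT.
exists (fun C x y => w (C, (x, y))); split=> [C x y xy c|].
  by have [] := Hw (C, (x, y)) xy c.
move=> C D x y z t dj xy zt c c' p q hp hq.
have [_ _ /(_ p hp)[a [b [aC bC ab pab]]]] := Hw (C, (x, y)) xy c.
have [_ _ /(_ q hq)[a' [b' [aC' bC' ab' pab']]]] := Hw (D, (z, t)) zt c'.
apply: (Hfar a b a' b' ab ab' _ p q pab pab').
apply: disjointWl (disjointWr _ dj);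
  by apply/fintype.subsetP => u; rewrite !inE => /orP[]/eqP->.
Qed.

(** Every branch set gets a centre, and an edge [ij] of the minor becomes a walk between centres
    inside [bs i :|: bs j]. For independent edges these unions are disjoint, so [crossings_pair]
    applies to each pair; [v] interprets the atoms. *)
Lemma minor_parity (m : nat) (bs : nat -> {set G}) (es : seq (nat * nat)) :
  (0 < m)%N -> (forall i, (i < m)%N -> connected_in (bs i)) ->
  (forall i, (i < m)%N -> bs i != finset.set0) ->
  (forall i j, (i < j < m)%N -> [disjoint bs i & bs j]) ->
  (forall e, e \in es -> (e.1 < e.2 < m)%N /\ touch (bs e.1) (bs e.2)) ->
  exists v, v [::] = true /\ xor_all v (parity_system es) = false.
Proof.
move=> m0 cn ne dj hes.
have {}dj i j : (i < m)%N -> (j < m)%N -> i != j -> [disjoint bs i & bs j].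
  rewrite neq_ltn => im jm /orP[ij|ji]; first by rewrite dj ?ij.
  by rewrite disjoint_sym dj // ji.
have [x0 _] : exists x0 : G, x0 \in bs 0 by have /set0Pn := ne 0 m0.
pose c i : G := odflt x0 [pick x in bs i].
have cP i : (i < m)%N -> c i \in bs i.
  move=> im; rewrite /c; case: pickP => //= none.
  by have /set0Pn[x] := ne i im; rewrite none.
have [pos [e [pinj e0 [w [wP wfar]]]]] := planar_walks.
have cneq i j : (i < m)%N -> (j < m)%N -> i != j -> c i != c j.
  move=> im jm ij; apply: contraTneq (cP j jm) => <-.
  by rewrite (disjointFr (dj i j im jm ij)) // cP.
pose W k l := w (bs k :|: bs l) (c k) (c l).
pose v (a : seq nat) := match a with
  | [::] => true
  | [:: i; j] => halfplane (pos (c i) - pos (c j))%R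
  | [:: i; k; l] => crossings_above (pos (c i)) (pos (c k)) (W k l)
  | _ => false end.
exists v; split=> //.
(* Only half-plane atoms with increasing indices are used; for the other order [halfplane_opp]
   negates the value, which accounts for the constant term. *)
have vside i j : (i < m)%N -> (j < m)%N -> i != j ->
    xor_all v (if (i < j)%N then [:: [:: i; j]] else [:: [::]; [:: j; i]]) =
    halfplane (pos (c i) - pos (c j))%R.
  move=> im jm ij; case: ifP => _ /=; first by rewrite addbF.
  rewrite addbF -halfplane_opp ?opprB // subr_eq0.
  by rewrite (inj_eq pinj) eq_sym cneq.
have E p q : p \in es -> q \in es -> independent p q ->
    xor_all v (parity_terms p q) = false.
  case: p q => i j [k l] /hes[/= /andP[ij jm] tij] /hes[/= /andP[kl lm] tkl].
  rewrite /independent /parity_terms /= => /and4P[ik il jk jl].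
  have im := ltn_trans ij jm; have km := ltn_trans kl lm.
  rewrite !xor_all_cat !vside //.
  have walk a b (am : (a < m)%N) (bm : (b < m)%N) (t : touch (bs a) (bs b)) :=
    touch_walk (cn a am) (cn b bm) t (cP a am) (cP b bm).
  have cij : c i != c j by rewrite cneq // ltn_eqF.
  have ckl : c k != c l by rewrite cneq // ltn_eqF.
  have wij := walk i j im jm tij; have wkl := walk k l km lm tkl.
  have [p1 l1] := wP _ _ _ cij wij; have [p2 l2] := wP _ _ _ ckl wkl.
  have dd : [disjoint bs i :|: bs j & bs k :|: bs l].
    rewrite -setI_eq0 finset.setIUl !finset.setIUr.
    by rewrite !(disjoint_setI0 (dj _ _ _ _ _)) // !finset.setU0.
  have := crossings_pair e0 p1 p2 (wfar _ _ _ _ _ _ dd cij ckl wij wkl).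
  by rewrite /= l1 l2 -/(W i j) -/(W k l) !addbA.
rewrite /parity_system.
suff H s : all (fun pq => [&& pq.1 \in es, pq.2 \in es & independent pq.1 pq.2]) s ->
    xor_all v (flatten [seq parity_terms pq.1 pq.2 | pq <- s]) = false.
  rewrite -[X in flatten X](@map_allpairs _ _ _ _ (fun pq => parity_terms pq.1 pq.2)
     (fun p q => (p, q))).
  apply: H; apply/allP => pq /allpairsPdep[p [q [pes]]].
  by rewrite mem_filter => /andP[/andP[ind _] qes] ->; rewrite pes qes.
elim: s => [|pq s IH] //; rewrite [all _ _]/= => /andP[/and3P[h1 h2 h3] /IH hs].
rewrite -[flatten _]/(parity_terms pq.1 pq.2 ++
  flatten [seq parity_terms pq.1 pq.2 | pq <- s]).
by rewrite xor_all_cat hs E.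
Qed.

(** Evaluated under [v], a system that cancels to the constant term alone would read 1 = 0. *)
Lemma no_minor m (bs : nat -> {set G}) es : (0 < m)%N ->
  (forall i, (i < m)%N -> connected_in (bs i)) ->
  (forall i, (i < m)%N -> bs i != finset.set0) ->
  (forall i j, (i < j < m)%N -> [disjoint bs i & bs j]) ->
  (forall e, e \in es -> (e.1 < e.2 < m)%N /\ touch (bs e.1) (bs e.2)) ->
  cancel_pairs (parity_system es) <> [:: [::]].
Proof.
move=> m0 cn ne dj hes E; have [v [v0 vs]] := minor_parity m0 cn ne dj hes.
by move: vs; rewrite -xor_all_cancel E /= v0.
Qed.

Lemma no_K33 (C1 C2 C3 : {set G}) (x1 x2 x3 : G) :
  connected_in C1 -> connected_in C2 -> connected_in C3 ->
  [disjoint C1 & C2] -> [disjoint C1 & C3] -> [disjoint C2 & C3] ->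
  uniq [:: x1; x2; x3] ->
  (forall x, x \in [:: x1; x2; x3] ->
    [/\ x \notin C1, x \notin C2 & x \notin C3] /\
    [/\ touch C1 [set x], touch C2 [set x] & touch C3 [set x]]) -> False.
Proof.
move=> c1 c2 c3 d12 d13 d23 un H.
have [[n11 n12 n13] [t11 t12 t13]] := H x1 (mem_head _ _).
have [[n21 n22 n23] [t21 t22 t23]] := H x2 ltac:(by rewrite !inE eqxx orbT).
have [[n31 n32 n33] [t31 t32 t33]] := H x3 ltac:(by rewrite !inE eqxx !orbT).
move: un; rewrite /= !inE negb_or => /and3P[/andP[ne12 ne13] ne23 _].
pose bs := nth finset.set0 [:: C1; C2; C3; [set x1]; [set x2]; [set x3]].
pose es := [seq (i, j) | i <- iota 0 3, j <- iota 3 3].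
have dC (C : {set G}) x : x \notin C -> [disjoint C & [set x]].
  by rewrite disjoint_sym disjoints1.
have ne (C D : {set G}) : touch C D -> C != finset.set0.
  by case=> a [b [aC _ _]]; apply/set0Pn; exists a.
(* That the parity system of the nine edges cancels to the constant is settled by evaluation. *)
apply: (@no_minor 6 bs es) => //.
- by move=> [|[|[|[|[|[|i]]]]]] //= _; apply: connected_in1.
- by move=> [|[|[|[|[|[|i]]]]]] //= _; rewrite /bs /= ?(ne _ _ t11) ?(ne _ _ t12)
    ?(ne _ _ t13) -?card_gt0 ?cards1.
- by move=> [|[|[|[|[|[|i]]]]]] [|[|[|[|[|[|j]]]]]]; rewrite ?andbF //= => _;
    first [exact: d12 | exact: d13 | exact: d23 | exact: dC
          | rewrite disjoints1 inE].
- apply/(@all_prop _ (fun e => (e.1 < e.2 < 6)%N /\ touch (bs e.1) (bs e.2))).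
  by do !split.
Qed.

(** The same evaluation for the ten edges of [K_5], with one contracted set [C]. It is applied to
    components outside a [K_4] and to an arc of a cycle. *)
Lemma no_K5 (C : {set G}) (a b c d : G) :
  connected_in C -> uniq [:: a; b; c; d] ->
  (forall x, x \in [:: a; b; c; d] -> x \notin C /\ touch C [set x]) ->
  adj a b -> adj a c -> adj a d -> adj b c -> adj b d -> adj c d -> False.
Proof.
move=> cC un H ab ac ad bc bd cd.
have [na ta] := H a (mem_head _ _).
have [nb tb] := H b ltac:(by rewrite !inE eqxx ?orbT).
have [nc tc] := H c ltac:(by rewrite !inE eqxx ?orbT).
have [nd td] := H d ltac:(by rewrite !inE eqxx ?orbT).
pose bs := nth finset.set0 [:: C; [set a]; [set b]; [set c]; [set d]].
pose es := [seq (i, j) | i <- iota 0 5, j <- [seq j <- iota 0 5 | (i < j)%N]].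
have t1 x y : adj x y -> touch [set x] [set y].
  by move=> xy; exists x, y; rewrite !inE.
have dC (D : {set G}) x : x \notin D -> [disjoint D & [set x]].
  by rewrite disjoint_sym disjoints1.
have ne D : touch C D -> C != finset.set0.
  by case=> x [y [aC _ _]]; apply/set0Pn; exists x.
move: un; rewrite /= !inE !negb_or => /and4P[/and3P[u1 u2 u3] /andP[u4 u5] u6 _].
apply: (@no_minor 5 bs es) => //.
- by move=> [|[|[|[|[|i]]]]] //= _; apply: connected_in1.
- by move=> [|[|[|[|[|i]]]]] //= _; rewrite /bs /= ?(ne _ ta) -?card_gt0 ?cards1.
- by move=> [|[|[|[|[|i]]]]] [|[|[|[|[|j]]]]]; rewrite ?andbF //= => _;
    first [exact: dC | rewrite disjoints1 inE].
- apply/(@all_prop _ (fun e => (e.1 < e.2 < 5)%N /\ touch (bs e.1) (bs e.2))).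
  by do !split=> //; apply: t1.
Qed.

End Minors.

(* The names of finite set theory shadowed by [classical_sets] are needed again. *)
From mathcomp Require Import all_boot.

(** * Components, paths and cycles *)

Section Components.
Variable G : sgraph.
Implicit Types (K C : {set G}) (x y z : G).

Lemma adj_neq x y : adj x y -> x != y.
Proof. by apply: contraTneq => ->; rewrite adj_irr. Qed.

Lemma touch1P C x : reflect (touch C [set x]) [exists y in C, adj y x].
Proof.
apply: (iffP exists_inP) => [[y yC yx]|[y [z [yC]]]].
  by exists y, x; rewrite inE.
by rewrite inE => /eqP-> yx; exists y.
Qed.

Definition component K x : {set G} := [set y | connect (adj_in (~: K)) x y].

Lemma adj_in_sym C : connect_sym (adj_in C).
Proof.
by apply: sym_connect_sym => x y; rewrite /adj_in /= andbCA adj_sym.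
Qed.

Lemma component_refl K x : x \in component K x.
Proof. by rewrite inE connect0. Qed.

Lemma component_ind K x (P : G -> Prop) : P x ->
  (forall y z, P y -> y \notin K -> z \notin K -> adj y z -> P z) ->
  forall y, y \in component K x -> P y.
Proof.
move=> Px step y; rewrite inE => /connectP[p + ->].
elim: p x Px => //= z p IH x Px /andP[/and3P[]]; rewrite !inE => xK zK xz.
by apply: IH; apply: step xz.
Qed.

Lemma component_notin K x y : x \notin K -> y \in component K x -> y \notin K.
Proof.
by move=> xK; move: y; apply: component_ind.
Qed.

Lemma component_closed K x y z : x \notin K -> y \in component K x ->
  adj y z -> z \notin K -> z \in component K x.
Proof.
move=> xK yC yz zK; have yK := component_notin xK yC.
move: yC; rewrite !inE => c; apply: connect_trans c _.
by apply: connect1; rewrite /adj_in /= !inE yK zK.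
Qed.

Lemma component_eq K x y : y \in component K x -> component K y = component K x.
Proof.
rewrite inE => c; apply/setP => z; rewrite !inE.
by rewrite (same_connect (@adj_in_sym _) c).
Qed.

Lemma component_connected K x : x \notin K -> connected_in (component K x).
Proof.
move=> xK.
suff H y : y \in component K x -> connect (adj_in (component K x)) x y.
  move=> y z /H xy /H xz; apply: connect_trans xz.
  by rewrite adj_in_sym.
move=> yC; suff [] : y \in component K x /\ connect (adj_in (component K x)) x y by [].
move: y yC; apply: component_ind; first by rewrite component_refl connect0.
move=> y z [yC xy] yK zK yz.
have zC := component_closed xK yC yz zK; split=> //.
by apply: connect_trans xy _; apply: connect1; rewrite /adj_in /= yC zC.
Qed.

Definition boundary C : {set G} := [set y | y \notin C & [exists x in C, adj x y]].

Lemma boundary_component K x : x \notin K -> boundary (component K x) \subset K.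
Proof.
move=> xK; apply/subsetP => y; rewrite inE => /andP[+ /exists_inP[z zC zy]].
by apply: contraR => yK; apply: component_closed zC zy yK.
Qed.

Lemma component_touch K x y t : x \notin K -> y \in component K x ->
  adj y t -> touch (component K x) [set t].
Proof. by move=> xK yC yt; exists y, t; rewrite inE. Qed.

Hypothesis tcG : three_connected G.

(** The boundary of [C] separates [x] from [z]: a walk avoiding it never leaves [C]. *)
Lemma boundary_ge3 C x z : x \in C -> z \notin C -> z \notin boundary C ->
  2 < #|boundary C|.
Proof.
move=> xC zC zB; rewrite ltnNge; apply/negP => small.
have [_ /(_ (boundary C) small x z)] := tcG.
have xB : x \notin boundary C by rewrite inE xC.
move=> /(_ xB zB) /connectP[p pp zl].
suff : last x p \in C by rewrite -zl (negbTE zC).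
elim: p x xC {xB zl} pp => //= y p IH x xC /andP[/and3P[_ yB xy]].
apply: IH; move: yB; rewrite inE negb_and negbK => /orP[//|].
by case/negP; apply/exists_inP; exists x.
Qed.

Lemma connected_setC (X : {set G}) : #|X| < 3 -> connected_in (~: X).
Proof.
move=> X3 x y; rewrite !inE => xX yX; have [_ /(_ X X3 x y xX yX)] := tcG.
by apply: connect_sub => a b /and3P[aX bX ab]; apply: connect1;
  rewrite /adj_in /= !inE aX bX.
Qed.

End Components.

Section Nonplanar.
Variables (R : realType) (G : sgraph).
Hypothesis planarG : planar R G.

Lemma no_K33_set (u v : G) (C : {set G}) (x1 x2 x3 : G) :
  connected_in C -> u != v -> u \notin C -> v \notin C ->
  uniq [:: x1; x2; x3] ->
  (forall x, x \in [:: x1; x2; x3] ->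
    [/\ x \notin C, adj u x, adj v x & touch C [set x]]) -> False.
Proof.
move=> cC uv uC vC un H.
apply: (@no_K33 _ _ planarG [set u] [set v] C x1 x2 x3) => //.
- exact: connected_in1.
- exact: connected_in1.
- by rewrite disjoints1 inE.
- by rewrite disjoints1.
- by rewrite disjoints1.
- move=> x /H[xC ux vx tx]; split; split=> //; rewrite ?inE.
  + by rewrite eq_sym adj_neq.
  + by rewrite eq_sym adj_neq.
  + by exists u, x; rewrite !inE.
  + by exists v, x; rewrite !inE.
Qed.

Lemma no_K33_sub (u v w x1 x2 x3 : G) :
  uniq [:: u; v; w] -> uniq [:: x1; x2; x3] ->
  (forall x, x \in [:: x1; x2; x3] -> [/\ adj u x, adj v x & adj w x]) -> False.
Proof.
move=> + un H; rewrite /= !inE negb_or => /andP[/andP[uv uw] /andP[vw _]].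
apply: (@no_K33_set u v [set w] x1 x2 x3) => //; rewrite ?inE //.
  exact: connected_in1.
move=> x /H[ux vx wx]; split=> //; last by exists w, x; rewrite !inE.
by rewrite inE eq_sym adj_neq.
Qed.

End Nonplanar.

Lemma isomorphic_from (G H : sgraph) (g : H -> G) :
  injective g -> (forall x, exists y, g y = x) ->
  (forall x y, adj (g x) (g y) = adj x y) -> isomorphic G H.
Proof.
move=> inj sur ad.
have /choice[f fK] := sur.
have gK : cancel g f by move=> y; apply: inj; rewrite fK.
by exists f; split=> [|x y]; [exists g | rewrite -ad !fK].
Qed.

Section PathCycle.
Variable G : sgraph.
Implicit Types (S : {set G}) (x y : G).

(** Here and in [cycle_like] chords are excluded, and the formulas are those of [path_graph] and
    [cycle_graph], so that [nth] becomes an isomorphism onto the induced subgraph. *)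
Definition path_like (s : seq G) := forall (x0 : G) i j,
  i < size s -> j < size s ->
  adj (nth x0 s i) (nth x0 s j) = (i.+1 == j) || (j.+1 == i).

Definition cycle_like (s : seq G) := 2 < size s /\ forall (x0 : G) i j,
  i < size s -> j < size s ->
  adj (nth x0 s i) (nth x0 s j) =
    (i != j) && ((i.+1 %% size s == j) || (j.+1 %% size s == i)).

(** The subgraph induced by [S] has maximum degree at most two. *)
Definition subcubic S := forall x y1 y2 y3, x \in S -> y1 \in S -> y2 \in S ->
  y3 \in S -> uniq [:: y1; y2; y3] -> adj x y1 -> adj x y2 -> adj x y3 -> False.

Lemma longest_path S x0 : x0 \in S -> exists s : seq G,
  [/\ uniq s, {subset s <= S}, sorted (@adj G) s, x0 \in S /\ s != [::] &
    forall t : seq G, uniq t -> {subset t <= S} -> sorted (@adj G) t -> size t <= size s].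
Proof.
move=> x0S.
pose P n := [exists t : n.-tuple G, [&& uniq t, all (mem S) t & sorted (@adj G) t]].
have PP (t : seq G) : uniq t -> {subset t <= S} -> sorted (@adj G) t -> P (size t).
  move=> ut tS st; apply/existsP; exists (in_tuple t).
  by rewrite ut st andbT; apply/allP.
have exP : exists n, P n.
  by exists 1; apply: (PP [:: x0]) => // y; rewrite inE => /eqP->.
have Pb n : P n -> n <= #|S|.
  case/existsP=> t /and3P[ut /allP tS _]; rewrite -(size_tuple t).
  by rewrite -(card_uniqP ut); apply/subset_leq_card/subsetP.
case: (ex_maxnP exP Pb) => n /existsP[t /and3P[ut /allP tS st]] mx.
exists t; split=> //.
- split=> //; rewrite -size_eq0 size_tuple -lt0n; apply: mx.
  by apply: (PP [:: x0]) => // y; rewrite inE => /eqP->.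
- by move=> t' ut' tS' st'; rewrite size_tuple; apply/mx/PP.
Qed.

(** Take a longest path in [S]. Inner vertices already have their two neighbours, and an end with a
    neighbour off the path would extend it, so by connectedness the path covers [S]; the only
    further edge possible joins its ends. *)
Lemma path_or_cycle S x0 : x0 \in S -> connected_in S -> subcubic S ->
  exists s : seq G, [/\ uniq s, s =i S & path_like s \/ cycle_like s].
Proof.
move=> x0S cS dS; have [s [us sS ss [_ s0] mx]] := longest_path x0S.
exists s.
have nthU i j : i < size s -> j < size s ->
    (nth x0 s i == nth x0 s j) = (i == j) by move=> ? ?; apply: nth_uniq.
have nthM i : i < size s -> nth x0 s i \in s by move=> ?; apply: mem_nth.
have adjS i : i.+1 < size s -> adj (nth x0 s i) (nth x0 s i.+1).
  by move=> h; move/sortedP: ss => /(_ x0) /(_ i h).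
have inS i : i < size s -> nth x0 s i \in S by move=> h; apply/sS/mem_nth.
have inner i j : 0 < i -> i.+1 < size s -> j < size s ->
    adj (nth x0 s i) (nth x0 s j) -> (j == i.-1) || (j == i.+1).
  move=> i0 i1 js ij; apply/norP=> -[/negP ni /negP nj].
  apply: (@dS (nth x0 s i) (nth x0 s i.-1) (nth x0 s i.+1) (nth x0 s j));
    rewrite ?inS //; try lia.
  - rewrite /= !inE !nthU; lia.
  - by rewrite adj_sym; have := adjS i.-1; rewrite prednK //; apply; lia.
  - by apply: adjS.
have closed y i : y \in S -> i < size s -> adj (nth x0 s i) y -> y \in s.
  move=> yS is_ iy; apply/negPn/negP => ys.
  have [i0|i0] := posnP i.
    have : size (y :: s) <= size s; last by rewrite /= ltnn.
    apply: mx; rewrite /= ?ys ?us //.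
      by move=> z; rewrite inE => /orP[/eqP->|/sS].
    move: iy ss {ys adjS inner inS nthU nthM}; rewrite i0.
    case: s {s0 us sS is_} => //= a s iy ->.
    by rewrite adj_sym iy.
  have [i1|i1] := ltnP i.+1 (size s).
    apply: (@dS (nth x0 s i) (nth x0 s i.-1) (nth x0 s i.+1) y);
      rewrite ?inS //; try lia.
    - rewrite /= !inE !nthU ?andbT; try lia.
      rewrite negb_or; apply/andP; split; last first.
        by apply: contraNneq ys => <-; apply: nthM.
      apply/andP; split; first lia.
      by apply: contraNneq ys => <-; apply: nthM; lia.
    - by rewrite adj_sym; have := adjS i.-1; rewrite prednK //; apply; lia.
    - by apply: adjS.
  have : size (rcons s y) <= size s; last by rewrite size_rcons ltnn.
  apply: mx; rewrite ?rcons_uniq ?ys ?us //.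
    by move=> z; rewrite mem_rcons inE => /orP[/eqP->|/sS].
  have ei : i = (size s).-1 by lia.
  move: iy ss; rewrite ei nth_last.
  case: s {s0 us sS is_ ys adjS inner inS nthU nthM i1 ei} => //= a s iy.
  by rewrite rcons_path => ->.
have sSE : s =i S.
  move=> y; apply/idP/idP => [/sS //|yS].
  have z0 : nth x0 s 0 \in s by rewrite mem_nth // lt0n size_eq0.
  have /connectP[p pp ->] := cS _ _ (sS _ z0) yS.
  elim: p (nth x0 s 0) z0 pp => //= z p IH x xs /andP[/and3P[xS zS xz]].
  apply: IH; move: xz; rewrite -(nth_index x0 xs); apply: closed => //.
  by rewrite index_mem.
split=> //.
have key i j : i < j -> j < size s -> adj (nth x0 s i) (nth x0 s j) ->
    i.+1 == j \/ (i = 0 /\ j = (size s).-1).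
  move=> ij js aij.
  have [i0|i0] := posnP i.
    have [j1|j1] := ltnP j.+1 (size s).
      by have := inner j i; rewrite adj_sym aij => /(_ _ j1 _ isT); lia.
    by right; lia.
  by have := inner i j i0 _ js aij; lia.
(* A closing edge gives a cycle only from three vertices on; with two vertices it is the edge of the
   path itself. *)
have [/andP[sz ends]|nends] := boolP ((2 < size s) &&
    adj (nth x0 s 0) (nth x0 s (size s).-1)).
- right; split=> // x i j is_ js.
  rewrite !(set_nth_default x0 x) //.
  wlog ij : i j is_ js / i < j.
    move=> H; have [ij|] := ltnP i j; first exact: H.
    rewrite leq_eqVlt => /orP[/eqP->|ji]; first by rewrite adj_irr eqxx.
    by rewrite adj_sym H // eq_sym orbC.
  rewrite (_ : i.+1 %% size s = i.+1); last by rewrite modn_small; lia.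
  apply/idP/idP => [/(key _ _ ij js)[h|[-> ->]]|].
  + by rewrite h; lia.
  + by rewrite prednK ?modnn ?orbT //; lia.
  + case/andP=> _ /orP[/eqP e|]; first by subst j; apply: adjS.
    have [j1|j1] := ltnP j.+1 (size s); first by rewrite modn_small //; lia.
    have -> : j.+1 = size s by lia.
    by rewrite modnn => /eqP <-; have -> : j = (size s).-1 by lia.
- left=> x i j is_ js; rewrite !(set_nth_default x0 x) //.
  wlog ij : i j is_ js / i < j.
    move=> H; have [ij|] := ltnP i j; first exact: H.
    rewrite leq_eqVlt => /orP[/eqP->|ji]; first by rewrite adj_irr; lia.
    by rewrite adj_sym H // orbC.
  apply/idP/idP => [aij|].
  + have [->//|[ei ej]] := key _ _ ij js aij.
    move: nends; rewrite -ei -ej aij andbT; lia.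
  + case/orP=> /eqP e; last lia.
    by subst j; apply: adjS.
Qed.

End PathCycle.

(** * Recognising joins with two poles *)

Lemma isomorphic_join (G H K : sgraph) (h : H -> G) (k : K -> G) :
  injective h -> injective k ->
  (forall x y, adj (h x) (h y) = adj x y) ->
  (forall x y, adj (k x) (k y) = adj x y) ->
  (forall x y, adj (h x) (k y)) ->
  (forall z, (exists x, h x = z) \/ (exists y, k y = z)) ->
  isomorphic G (join H K).
Proof.
move=> hi ki ha ka hk cover.
pose g (t : join H K) : G := match t with inl x => h x | inr y => k y end.
apply: (@isomorphic_from _ _ g).
- move=> [x|x] [y|y] /=; [by move/hi->| | | by move/ki->] => e.
    by have := hk x y; rewrite e adj_irr.
  by have := hk y x; rewrite e adj_irr.
- move=> z; case: (cover z) => [[x <-]|[y <-]]; [by exists (inl x)|by exists (inr y)].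
- by move=> [x|x] [y|y] //=; rewrite ?ha ?ka ?hk // adj_sym hk.
Qed.

Section Poles.
Variable G : sgraph.
Variables (s : seq G) (a b : G).
Hypotheses (us : uniq s) (ab : a != b).
Hypothesis adj_as : forall x, x \in s -> adj a x /\ adj b x.
Hypothesis cover : forall x, [|| x \in s, x == a | x == b].

Let h (i : 'I_(size s)) : G := nth a s i.
Let k (j : 'I_2) : G := if j == ord0 then a else b.

Let h_mem i : h i \in s. Proof. exact: mem_nth. Qed.

Let h_inj : injective h.
Proof. by move=> i j /eqP; rewrite /h nth_uniq // => /eqP/val_inj. Qed.

Let k_inj : injective k.
Proof.
have ba := ab; rewrite eq_sym in ba.
by move=> [[|[|//]] ?] [[|[|//]] ?]; rewrite /k /= => e; apply: val_inj => //=;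
  move: ab ba; rewrite e eqxx.
Qed.

Let hk x y : adj (h x) (k y).
Proof.
by rewrite /k; have [? ?] := adj_as (h_mem x); case: ifP; rewrite adj_sym.
Qed.

Let hk_cover z : (exists x, h x = z) \/ (exists y, k y = z).
Proof.
have /or3P[zs|/eqP->|/eqP->] := cover z.
- by left; move: (zs); rewrite -index_mem => i; exists (Ordinal i); rewrite /h /= nth_index.
- by right; exists ord0.
- by right; exists ord_max.
Qed.

Lemma isomorphic_T : path_like s -> adj a b -> isomorphic G (T (size s)).
Proof.
move=> pl aab; apply: (@isomorphic_join G (path_graph _) (complete_graph 2) h k) => // x y.
  by rewrite /h pl.
have ba : adj b a by rewrite adj_sym.
rewrite -[RHS]/(x != y) /k -!val_eqE.
by case: x y => [[|[|//]] ?] [[|[|//]] ?] /=; rewrite ?adj_irr ?aab ?ba.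
Qed.

Lemma isomorphic_B' : path_like s -> ~~ adj a b -> isomorphic G (B' (size s)).
Proof.
move=> pl /negbTE aab.
apply: (@isomorphic_join G (path_graph _) (empty_graph 2) h k) => // x y.
  by rewrite /h pl.
have ba : adj b a = false by rewrite adj_sym.
by rewrite /k; case: ifP; case: ifP; rewrite ?adj_irr ?aab ?ba.
Qed.

Lemma isomorphic_B : cycle_like s -> ~~ adj a b -> isomorphic G (B (size s)).
Proof.
move=> [_ pl] /negbTE aab.
apply: (@isomorphic_join G (cycle_graph _) (empty_graph 2) h k) => // x y.
  by rewrite /h pl.
have ba : adj b a = false by rewrite adj_sym.
by rewrite /k; case: ifP; case: ifP; rewrite ?adj_irr ?aab ?ba.
Qed.

End Poles.

Lemma uniq3E (T : eqType) (x y z : T) :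
  uniq [:: x; y; z] = [&& x != y, x != z & y != z].
Proof. by rewrite /= !inE negb_or andbT andbA. Qed.

Lemma all3 (T : eqType) (P : T -> Prop) (x y z : T) :
  P x -> P y -> P z -> forall t, t \in [:: x; y; z] -> P t.
Proof. by move=> Px Py Pz t; rewrite !inE => /or3P[]/eqP->. Qed.

Lemma all4 (T : eqType) (P : T -> Prop) (x y z u : T) :
  P x -> P y -> P z -> P u -> forall t, t \in [:: x; y; z; u] -> P t.
Proof. by move=> Px Py Pz Pu t; rewrite !inE => /or4P[]/eqP->. Qed.

Lemma exists_subset (T : finType) (D : {set T}) k : k <= #|D| ->
  exists2 S : {set T}, S \subset D & #|S| = k.
Proof.
move=> kD; exists [set x in take k (enum D)].
  by apply/subsetP => x; rewrite inE => /mem_take; rewrite mem_enum.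
rewrite cardsE (card_uniqP _) ?take_uniq ?enum_uniq // size_take -cardE.
by case: ltngtP kD.
Qed.

Section TwoPoles.
Variables (R : realType) (G : sgraph).
Hypotheses (planarG : planar R G) (tcG : three_connected G).

(** A vertex with three neighbours in [S] would form a [K_{3,3}] together with [a] and [b]. *)
Lemma subcubic_poles (S : {set G}) (a b : G) : a != b ->
  (forall x, x \in S -> adj a x /\ adj b x) -> subcubic S.
Proof.
move=> ab H x y1 y2 y3 xS y1S y2S y3S un x1 x2 x3.
have [ax bx] := H x xS.
have [? ?] := H y1 y1S; have [? ?] := H y2 y2S; have [? ?] := H y3 y3S.
apply: (@no_K33_sub _ _ planarG a b x y1 y2 y3) => //.
  by rewrite uniq3E ab !adj_neq.
by apply: all3; split=> //; case: (H _ _ : _ /\ _).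
Qed.

(** A vertex other than [v] and [w] outside [N(v)] lies in a component that touches only [N(v)],
    hence by 3-connectedness at least three vertices of it, and contracting it gives a [K_{3,3}]
    with [v] and [w]. So [N(v)] is everything but the two poles, connected and of maximum degree
    two. The last conclusion serves to rule out maximum degree 3. *)
Lemma twin_structure (v w : G) : v != w -> nbrs v = nbrs w -> 2 < #|nbrs v| ->
  (isomorphic G (B #|nbrs v|) \/ isomorphic G (B' #|nbrs v|)) /\
  exists x : G, 3 < #|nbrs x|.
Proof.
move=> vw Nvw N3; set S := nbrs v in N3 *.
have vS x : (x \in S) = adj v x by rewrite inE.
have wS x : (x \in S) = adj w x by rewrite /S Nvw inE.
have nvw : ~~ adj v w by rewrite -vS wS adj_irr.
have cover x : [|| x \in S, x == v | x == w].
  apply/negPn; rewrite !negb_or; apply/negP => /and3P[xS xv xw].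
  pose K := [set v; w] :|: S.
  have xK : x \notin K by rewrite !inE !negb_or xv xw -vS xS.
  have CK := boundary_component xK; set C := component K x in CK *.
  have CS : boundary C \subset S.
    apply/subsetP => y yB; have := subsetP CK y yB; rewrite !inE.
    move: yB; rewrite inE => /andP[_ /exists_inP[z zC zy]].
    have zK := component_notin xK zC.
    have zS : z \notin S by apply: contraNN zK; rewrite in_setU orbC => ->.
    case/orP=> // /orP[]/eqP e; subst y.
      by move: zy; rewrite adj_sym -vS (negbTE zS).
    by move: zy; rewrite adj_sym -wS (negbTE zS).
  have vC : v \notin C by apply/negP => /(component_notin xK); rewrite !inE eqxx.
  have wC : w \notin C by apply/negP => /(component_notin xK); rewrite !inE eqxx orbT.
  have vB : v \notin boundary C.
    by apply/negP => /(subsetP CS); rewrite vS adj_irr.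
  have := boundary_ge3 tcG (component_refl K x) vC vB.
  case/card_gt2P => x1 [x2 [x3 [[h1 h2 h3] [n12 n23 n31]]]].
  apply: (@no_K33_set _ _ planarG v w C x1 x2 x3) => //.
  - exact: component_connected.
  - by rewrite uniq3E n12 n23 eq_sym n31.
  - have H y : y \in boundary C ->
      [/\ y \notin C, adj v y, adj w y & touch C [set y]].
      move=> yB; rewrite -vS -wS (subsetP CS) //; move: yB; rewrite inE.
      by case/andP=> yC /touch1P.
    by apply: all3; apply: H.
have CS : ~: [set v; w] = S.
  apply/setP => x; rewrite in_setC in_set2; have := cover x.
  case: eqVneq => [->|_] /=; first by rewrite vS adj_irr.
  by case: eqVneq => [->|_] /=; [rewrite wS adj_irr | rewrite orbF => ->].
have cS : connected_in S by rewrite -CS; apply: connected_setC; rewrite // cards2 vw.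
have [x0 x0S] : exists x, x \in S by apply/set0Pn; rewrite -card_gt0; lia.
have dS : subcubic S.
  by apply: (subcubic_poles vw) => x xS; rewrite -vS -wS.
have [s [us sS sl]] := path_or_cycle x0S cS dS.
have szs : size s = #|S| by rewrite -(card_uniqP us); apply: eq_card.
have sadj x : x \in s -> adj v x /\ adj w x by rewrite sS -vS -wS.
have scov x : [|| x \in s, x == v | x == w] by rewrite sS.
split; last first.
  (* The second vertex of the path or cycle is adjacent to both poles and to its two neighbours
     [y 0] and [y 2]. *)
  pose y i := nth x0 s i.
  have yS i : i < 3 -> y i \in S.
    by move=> i3; rewrite -sS; apply: mem_nth; rewrite szs; apply: leq_trans i3 N3.
  have sz3 : 2 < size s by rewrite szs.
  have le3 i : i < 3 -> i < size s by move=> i3; apply: leq_trans sz3.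
  exists (y 1).
  have y10 : adj (y 1) (y 0) by case: sl => [|[_]] sl; rewrite sl ?le3 // !modn_small ?le3.
  have y12 : adj (y 1) (y 2).
    by case: sl => [|[_]] sl; rewrite sl ?le3 // modn_small.
  have un : uniq [:: v; w; y 0; y 2].
    have := vS (y 0); have := wS (y 0); have := vS (y 2); have := wS (y 2).
    rewrite !yS // => /esym/adj_neq e1 /esym/adj_neq e2 /esym/adj_neq e3 /esym/adj_neq e4.
    by rewrite /= !inE !negb_or vw e1 e2 e3 e4 nth_uniq ?le3.
  rewrite -[4]/(size [:: v; w; y 0; y 2]) -(card_uniqP un).
  apply/subset_leq_card/subsetP => z.
  rewrite [z \in nbrs _]inE; move: z; apply: all4 => //.
    by rewrite adj_sym -vS yS.
  by rewrite adj_sym -wS yS.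
rewrite -szs; case: sl => sl; [right|left].
- exact: (isomorphic_B' us vw).
- exact: (isomorphic_B us vw).
Qed.

End TwoPoles.

(** * The sets A_n *)

Section CommonNeighbors.
Variable G : sgraph.
Implicit Types (u : seq G) (x y : G).

Lemma mem_common u x :
  reflect (forall y, y \in u -> adj x y) (x \in common_nbrs u).
Proof. by rewrite inE; apply: allP. Qed.

Lemma AP n a : A n G a <->
  exists u, [/\ uniq u, size u = n & #|common_nbrs u| = a].
Proof.
split=> [[u [uu ca]]|[u [uu su ca]]].
  by exists u; rewrite size_tuple.
by exists (Tuple (introT eqP su)).
Qed.

Lemma common_disjoint u : [disjoint [set y in u] & common_nbrs u].
Proof.
rewrite disjoint_subset; apply/subsetP => y; rewrite !inE => yu.
by apply/negP => /allP/(_ y yu); rewrite adj_irr.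
Qed.

Lemma A_bound n a : A n G a -> a + n <= #|G|.
Proof.
case/AP=> u [uu <- <-]; rewrite addnC -(card_uniqP uu).
have -> : #|u| = #|[set y in u]| by rewrite cardsE.
rewrite -cardsUI (disjoint_setI0 (common_disjoint u)) cards0 addn0.
exact: max_card.
Qed.

Lemma A0_succ n : A n G 0 -> n < #|G| -> A n.+1 G 0.
Proof.
case/AP=> u [uu su /eqP]; rewrite cards_eq0 => /eqP c0 nG.
have [x xu] : exists x, x \notin u.
  case: (pickP [pred x | x \notin u]) => [x xu|none]; first by exists x.
  move: nG; rewrite ltnNge -su -(card_uniqP uu); case/negP.
  apply/subset_leq_card/subsetP => z _; apply/negPn/negP => zu.
  by have := none z; rewrite /= zu.
apply/AP; exists (x :: u); rewrite /= xu uu su; split=> //.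
apply/eqP; rewrite cards_eq0 -subset0 -c0; apply/subsetP => z /mem_common h.
by apply/mem_common => y yu; apply: h; rewrite inE yu orbT.
Qed.

Lemma A0_mono m n : A m G 0 -> m <= n <= #|G| -> A n G 0.
Proof.
move=> h /andP[]; elim: n => [|n IH].
  by rewrite leqn0 => /eqP m0 _; rewrite m0 in h.
rewrite leq_eqVlt => /orP[/eqP <- //|mn nG].
by apply: A0_succ => //; apply: IH => //; apply: ltnW.
Qed.

Definition K33_free := forall x1 x2 x3 y1 y2 y3 : G,
  uniq [:: x1; x2; x3] -> uniq [:: y1; y2; y3] ->
  (forall x, x \in [:: x1; x2; x3] -> [/\ adj x y1, adj x y2 & adj x y3]) ->
  False.

Lemma A_le2 n a : K33_free -> 2 < n -> A n G a -> a <= 2.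
Proof.
move=> free n3 /AP[u [uu su <-]]; rewrite leqNgt; apply/card_gt2P.
case=> y1 [y2 [y3 [[c1 c2 c3] [n12 n23 n31]]]].
case: u uu su c1 c2 c3 => [|x1 [|x2 [|x3 u]]]; try by move=> _ h; rewrite -h in n3.
rewrite /= !inE !negb_or => /and4P[/and3P[h12 h13 _] /andP[h23 _] _ _] _.
move=> /and4P[? ? ? _] /and4P[? ? ? _] /and4P[? ? ? _].
apply: (free x1 x2 x3 y1 y2 y3); rewrite ?uniq3E ?h12 ?h13 ?h23 ?n12 ?n23 1?eq_sym ?n31 //.
by apply: all3; rewrite ![adj _ y1]adj_sym ![adj _ y2]adj_sym ![adj _ y3]adj_sym.
Qed.

End CommonNeighbors.

Lemma A_iso (G H : sgraph) n a : isomorphic G H -> A n G a <-> A n H a.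
Proof.
move=> [f [[g fK gK] fa]].
have ga x y : adj (g x) (g y) = adj x y by rewrite -fa !gK.
have half (G1 G2 : sgraph) (h : G1 -> G2) (k : G2 -> G1) : cancel h k ->
    cancel k h -> (forall x y, adj (h x) (h y) = adj x y) -> A n G1 a -> A n G2 a.
  move=> hK kK ha /AP[u [uu su <-]]; apply/AP; exists (map h u).
  rewrite (map_inj_uniq (can_inj hK)) uu size_map su; split=> //.
  rewrite -(card_imset _ (can_inj hK)); apply: eq_card => z.
  apply/mem_common/imsetP => [c|[x /mem_common c ->] y /mapP[t tu ->]].
    exists (k z); rewrite ?kK //; apply/mem_common => y yu.
    by rewrite -ha kK; apply/c/map_f.
  by rewrite ha; apply: c.
by split; apply: half; eassumption.
Qed.

(** * Evaluating [A] on explicit finite graphs *)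

Section Computation.
Variables (G : sgraph) (k : nat) (f : nat -> G) (adjn : rel nat).
Hypothesis f_inj : forall i j, i < k -> j < k -> f i = f j -> i = j.
Hypothesis f_sur : forall x, exists2 i, i < k & f i = x.
Hypothesis f_adj : forall i j, i < k -> j < k -> adj (f i) (f j) = adjn i j.

Fixpoint subseqs (s : seq nat) (n : nat) : seq (seq nat) :=
  match n, s with
  | 0, _ => [:: [::]]
  | _, [::] => [::]
  | n'.+1, x :: s' => map (cons x) (subseqs s' n') ++ subseqs s' n
  end.

Lemma mem_subseqs s n c : (c \in subseqs s n) = subseq c s && (size c == n).
Proof.
elim: s n c => [|x s IH] [|n] c.
- by rewrite inE; case: c.
- by case: c.
- by rewrite inE; case: c => [|y c]; rewrite ?sub0seq ?andbF.
- rewrite [subseqs _ _]/= mem_cat IH; case: c => [|y c].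
    rewrite andbF orbF; apply/negP; case/mapP=> d _; by [].
  rewrite [subseq _ (x :: s)]/= eqSS; case: (eqVneq y x) => [->|ne].
    rewrite mem_map ?IH; last by move=> ? ? [].
    by apply/orb_idr => /andP[h ->]; rewrite (subseq_trans (subseq_cons _ _) h).
  rewrite (_ : _ \in map _ _ = false) //; apply/negP; case/mapP=> d _ [e _].
  by rewrite e eqxx in ne.
Qed.

(** Common neighbours do not depend on the order of the tuple, so increasing subsequences of the
    vertex numbers are enough. *)
Definition A_list n :=
  [seq count (fun x => all (adjn x) c) (iota 0 k) | c <- subseqs (iota 0 k) n].

Lemma A_compute n a : A n G a <-> a \in A_list n.
Proof.
pose E := [seq f i | i <- iota 0 k].
have uE : uniq E.
  rewrite map_inj_in_uniq ?iota_uniq // => i j; rewrite !mem_iota /= add0n.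
  exact: f_inj.
have EP : E =i G.
  by move=> x; have [i ik <-] := f_sur x; rewrite map_f ?mem_iota.
have cnt c : {subset c <= iota 0 k} ->
    #|common_nbrs (map f c)| = count (fun x => all (adjn x) c) (iota 0 k).
  move=> ck; rewrite cardE -(size_filter) /=.
  transitivity (size (filter (fun x => all (adj x) (map f c)) E)).
    apply: perm_size; apply: uniq_perm; rewrite ?enum_uniq ?filter_uniq //.
    by move=> x; rewrite mem_enum mem_filter EP inE andbT.
  rewrite filter_map size_map; congr size; apply: eq_in_filter => i.
  rewrite mem_iota /= add0n all_map => ik; apply: eq_in_all => j /ck.
  by rewrite mem_iota /= add0n => jk; rewrite f_adj.
rewrite AP; split=> [[u [uu su <-]]|/mapP[c]].
  pose c := [seq i <- iota 0 k | f i \in u].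
  have cu : map f c =i u.
    move=> x; apply/mapP/idP => [[i + ->]|xu]; first by rewrite mem_filter => /andP[].
    by have [i ik e] := f_sur x; exists i => //; rewrite mem_filter mem_iota e xu.
  have ck : {subset c <= iota 0 k} by move=> i; rewrite mem_filter => /andP[].
  have uc : uniq (map f c).
    rewrite map_inj_in_uniq ?filter_uniq ?iota_uniq // => i j /ck + /ck.
    by rewrite !mem_iota /= add0n; apply: f_inj.
  apply/mapP; exists c.
    rewrite mem_subseqs filter_subseq -su -(size_map f); apply/eqP.
    by apply: perm_size; apply: uniq_perm.
  rewrite -cnt //; congr #|pred_of_set _|; apply/setP => x; rewrite !inE.
  exact: eq_all_r.
rewrite mem_subseqs => /andP[sc /eqP sz] ->.
have ck := mem_subseq sc.
exists (map f c); rewrite size_map cnt //; split=> //.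
rewrite map_inj_in_uniq ?(subseq_uniq sc) ?iota_uniq // => i j /ck + /ck.
by rewrite !mem_iota /= add0n; apply: f_inj.
Qed.

End Computation.

(** Both sizes are successors because [inord] needs an inhabited ordinal type. *)
Definition sum_vertex k l (i : nat) : 'I_k.+1 + 'I_l.+1 :=
  if i <= k then inl (inord i) else inr (inord (i - k.+1)).

Lemma sum_vertex_inj k l i j : i < k.+1 + l.+1 -> j < k.+1 + l.+1 ->
  sum_vertex k l i = sum_vertex k l j -> i = j.
Proof.
rewrite /sum_vertex => ik jk; case: leqP => hi; case: leqP => hj // [];
  move/(congr1 (fun x => nat_of_ord x)); rewrite !inordK; lia.
Qed.

Lemma sum_vertex_sur k l x : exists2 i, i < k.+1 + l.+1 & sum_vertex k l i = x.
Proof.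
case: x => x; have := ltn_ord x => xk.
  exists (nat_of_ord x); first lia.
  by rewrite /sum_vertex -ltnS xk inord_val.
exists (k.+1 + x); first lia.
by rewrite /sum_vertex leqNgt leq_addr /= addKn inord_val.
Qed.

Definition stacked_adj (N : seq (seq nat)) : rel nat := fun i j =>
  if i < 4 then (if j < 4 then i != j else i \in nth [::] N (j - 4))
  else (j < 4) && (j \in nth [::] N (i - 4)).

Lemma A_stacked (M : seq (seq nat)) n a (N : seq nat) (l := size M) :
  A n (stackedK4 (N :: M)) a <->
  a \in A_list (4 + l.+1) (stacked_adj (N :: M)) n.
Proof.
apply: (@A_compute (stackedK4 (N :: M)) _ (sum_vertex 3 l)).
- exact: (@sum_vertex_inj 3 _).
- exact: (@sum_vertex_sur 3 _).
- move=> i j ik jk; rewrite /sum_vertex /stacked_adj !ltnS.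
  case: (leqP i 3) => hi; case: (leqP j 3) => hj /=; rewrite ?inordK //; try lia.
  by rewrite -[LHS]/(inord i != inord j) -val_eqE /= !inordK.
Qed.

Lemma A_K4 n a : A n K4 a <-> a \in A_list 4 (fun i j => i != j) n.
Proof.
apply: (@A_compute K4 _ (fun i => inord i : 'I_4)).
- by move=> i j ik jk /(congr1 (fun x => nat_of_ord x)); rewrite !inordK.
- by move=> x; exists (nat_of_ord x); rewrite ?ltn_ord ?inord_val.
- move=> i j ik jk; rewrite -[LHS]/(inord i != inord j :> 'I_4) -val_eqE /=.
  by rewrite !inordK.
Qed.

Lemma A_B4 n a : A n (B 4) a <-> a \in A_list 6 (fun i j =>
  if i < 4 then (if j < 4 then (i != j) && ((i.+1 %% 4 == j) || (j.+1 %% 4 == i))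
                 else true)
  else j < 4) n.
Proof.
apply: (@A_compute (B 4) _ (sum_vertex 3 1)).
- exact: (@sum_vertex_inj 3 1).
- exact: (@sum_vertex_sur 3 1).
- move=> i j ik jk; rewrite /sum_vertex !ltnS.
  case: (leqP i 3) => hi; case: (leqP j 3) => hj //=.
  by rewrite -[LHS]/(cycle_adj (inord i) (inord j)) /cycle_adj -val_eqE /= !inordK.
Qed.

Lemma A_B'4 n a : A n (B' 4) a <-> a \in A_list 6 (fun i j =>
  if i < 4 then (if j < 4 then (i.+1 == j) || (j.+1 == i) else true)
  else j < 4) n.
Proof.
apply: (@A_compute (B' 4) _ (sum_vertex 3 1)).
- exact: (@sum_vertex_inj 3 1).
- exact: (@sum_vertex_sur 3 1).
- move=> i j ik jk; rewrite /sum_vertex !ltnS.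
  case: (leqP i 3) => hi; case: (leqP j 3) => hj //=.
  by rewrite -[LHS]/(path_adj (inord i) (inord j)) /path_adj !inordK.
Qed.

Lemma A3_B'4 : A 3 (B' 4) 1. Proof. by rewrite A_B'4. Qed.

Lemma A4_B'4 : A 4 (B' 4) 1. Proof. by rewrite A_B'4. Qed.

(** * The families [T], [B] and [B'] *)

Section JoinTwo.
Variables (H K : sgraph) (p0 p1 : K).
Hypotheses (p01 : p0 != p1) (pcover : forall p, p = p0 \/ p = p1).
Let G := join H K.

Hypothesis subcubicH : forall h y1 y2 y3 : H, uniq [:: y1; y2; y3] ->
  adj h y1 -> adj h y2 -> adj h y3 -> False.
Hypothesis noC4 : forall h h' y y' : H, h != h' -> y != y' ->
  adj h y -> adj h y' -> adj h' y -> adj h' y' -> False.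

Lemma two_of_three (x1 x2 x3 : G) : uniq [:: x1; x2; x3] ->
  (exists h h' : H, [/\ h != h', inl h \in [:: x1; x2; x3] & inl h' \in [:: x1; x2; x3]])
  \/ (exists h : H, [/\ inl h \in [:: x1; x2; x3], inr p0 \in [:: x1; x2; x3]
        & inr p1 \in [:: x1; x2; x3]]).
Proof.
rewrite uniq3E; case: x1 => x1; case: x2 => x2; case: x3 => x3 /and3P[n12 n13 n23];
  do ?[by left; exists x1, x2; rewrite !inE !eqxx ?orbT
      |by left; exists x1, x3; rewrite !inE !eqxx ?orbT
      |by left; exists x2, x3; rewrite !inE !eqxx ?orbT].
- right; exists x1; rewrite !inE.
  by case: (pcover x2) (pcover x3) n23 => -> [] ->; rewrite !eqxx ?orbT.
- right; exists x2; rewrite !inE.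
  by case: (pcover x1) (pcover x3) n13 => -> [] ->; rewrite !eqxx ?orbT.
- right; exists x3; rewrite !inE.
  by case: (pcover x1) (pcover x2) n12 => -> [] ->; rewrite !eqxx ?orbT.
- by case: (pcover x1) (pcover x2) (pcover x3) n12 n13 n23 => -> [] -> [] ->;
    rewrite ?eqxx.
Qed.

Lemma no_common_pole (p : G) : adj p (inr p0) -> adj p (inr p1) ->
  exists h : H, p = inl h.
Proof.
case: p => [h|p]; first by exists h.
by case: (pcover p) => ->; rewrite /= ?adj_irr // => _; rewrite adj_irr.
Qed.

(** If one side contains both poles, the other lies in [H] and the third vertex of the first side
    has three neighbours in [H]. Otherwise each side has two vertices in [H], which form a
    four-cycle. *)
Lemma join2_K33_free : K33_free G.
Proof.
have half (x1 x2 x3 y1 y2 y3 : G) : uniq [:: x1; x2; x3] -> uniq [:: y1; y2; y3] ->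
    (forall x y, x \in [:: x1; x2; x3] -> y \in [:: y1; y2; y3] -> adj x y) ->
    inr p0 \in [:: x1; x2; x3] -> inr p1 \in [:: x1; x2; x3] ->
    (exists h : H, inl h \in [:: x1; x2; x3]) -> False.
  move=> ux uy ad i0 i1 [h hx].
  have inH y : y \in [:: y1; y2; y3] -> exists t : H, y = inl t.
    by move=> iy; apply: no_common_pole; rewrite adj_sym; apply: ad.
  have [t1 e1] := inH y1 (mem_head _ _).
  have [t2 e2] := inH y2 ltac:(by rewrite !inE eqxx orbT).
  have [t3 e3] := inH y3 ltac:(by rewrite !inE eqxx !orbT).
  have ad' t : inl t \in [:: y1; y2; y3] -> adj h t by move=> ty; apply: (ad _ _ hx ty).
  apply: (@subcubicH h t1 t2 t3); try by apply: ad'; rewrite !inE ?e1 ?e2 ?e3 eqxx ?orbT.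
  by move: uy; rewrite !uniq3E e1 e2 e3.
move=> x1 x2 x3 y1 y2 y3 ux uy ad.
have ad' x y : x \in [:: x1; x2; x3] -> y \in [:: y1; y2; y3] -> adj x y.
  by move=> /ad[? ? ?]; rewrite !inE => /or3P[]/eqP->.
have ad'' y x : y \in [:: y1; y2; y3] -> x \in [:: x1; x2; x3] -> adj y x.
  by move=> ? ?; rewrite adj_sym; apply: ad'.
case: (two_of_three ux) => [[h [h' [hh hx hx']]]|[h [hx i0 i1]]]; last first.
  by apply: half ux uy ad' i0 i1 _; exists h.
case: (two_of_three uy) => [[t [t' [tt ty ty']]]|[t [ty i0 i1]]]; last first.
  by apply: half uy ux ad'' i0 i1 _; exists t.
by apply: (noC4 hh tt); [apply: (ad' _ _ hx ty)|apply: (ad' _ _ hx ty')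
  |apply: (ad' _ _ hx' ty)|apply: (ad' _ _ hx' ty')].
Qed.

Lemma card_join2 : #|G| = #|H| + 2.
Proof.
have KE : [set: K] = [set p0; p1].
  by apply/setP => p; rewrite !inE; case: (pcover p) => ->; rewrite eqxx ?orbT.
by rewrite card_sum -[X in _ + X]cardsT KE cards2 p01.
Qed.

(** Any [n] vertices of [H] see both poles, and a third common neighbour would make a [K_{3,3}]. *)
Lemma A2_join2 n : 2 < n <= #|H| -> A n G 2.
Proof.
case/andP=> n3 nH; apply/AP.
pose u : seq G := [seq inl h | h <- take n (enum H)].
have su : size u = n by rewrite size_map size_take -cardE; case: ltngtP nH.
have uu : uniq u by rewrite map_inj_uniq ?take_uniq ?enum_uniq // => ? ? [].
exists u; split=> //; apply/eqP; rewrite eqn_leq; apply/andP; split.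
  by apply: (@A_le2 G n) => //; [exact: join2_K33_free|apply/AP; exists u].
have <- : #|[set (inr p0 : G); inr p1]| = 2.
  by rewrite cards2 (inj_eq (@inr_inj _ _)) p01.
apply/subset_leq_card/subsetP => x; rewrite !inE => /orP[]/eqP->;
  by apply/allP => y /mapP[h _ ->].
Qed.

Lemma uniq_inl3 (u : seq G) : uniq u -> 4 < size u ->
  exists h1 h2 h3 : H, [/\ uniq [:: h1; h2; h3], inl h1 \in u, inl h2 \in u & inl h3 \in u].
Proof.
move=> uu su; pose D := [set y in u] :\: [set (inr p0 : G); inr p1].
have : 2 < #|D|.
  have := cardsID [set (inr p0 : G); inr p1] [set y in u].
  have -> : #|[set y in u]| = size u by rewrite cardsE (card_uniqP uu).
  rewrite -/D.
  have := subset_leq_card (subsetIr [set y in u] [set (inr p0 : G); inr p1]).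
  by rewrite cards2; lia.
have DH y : y \in D -> exists2 h : H, y = inl h & inl h \in u.
  rewrite !inE; case: y => [h|p]; first by move=> hu; exists h.
  by case: (pcover p) => ->; rewrite eqxx ?orbT.
case/card_gt2P=> y1 [y2 [y3 [[/DH[h1 e1 ?] /DH[h2 e2 ?] /DH[h3 e3 ?]]]]].
rewrite e1 e2 e3 !(inj_eq (@inl_inj _ _)) => -[n12 n23 n31].
by exists h1, h2, h3; split=> //; rewrite uniq3E n12 n23 eq_sym n31.
Qed.

End JoinTwo.

Section PathFamily.
Variable m : nat.
Let H := path_graph m.

Lemma path_subcubic (h y1 y2 y3 : H) : uniq [:: y1; y2; y3] ->
  adj h y1 -> adj h y2 -> adj h y3 -> False.
Proof.
by rewrite uniq3E -!val_eqE /= /path_adj => /and3P[]; lia.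
Qed.

Lemma path_noC4 (h h' y y' : H) : h != h' -> y != y' ->
  adj h y -> adj h y' -> adj h' y -> adj h' y' -> False.
Proof. by rewrite -!val_eqE /= /path_adj; lia. Qed.

End PathFamily.

Section CycleFamily.
Variable m : nat.
Hypothesis m5 : 4 < m.
Let H := cycle_graph m.

Lemma cycle_adjE (i j : H) : adj i j =
  [|| i.+1 == j, j.+1 == i, (i.+1 == m) && (j == 0 :> nat)
    | (j.+1 == m) && (i == 0 :> nat)].
Proof.
have S (k : H) : k.+1 %% m = if k.+1 == m then 0 else k.+1.
  case: eqVneq => [->|ne]; first by rewrite modnn.
  by rewrite modn_small //; have := ltn_ord k; lia.
rewrite -[LHS]/(cycle_adj i j) /cycle_adj -val_eqE /= !S.
have := ltn_ord i; have := ltn_ord j.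
by case: (eqVneq i.+1 m); case: (eqVneq j.+1 m); lia.
Qed.

Lemma cycle_subcubic (h y1 y2 y3 : H) : uniq [:: y1; y2; y3] ->
  adj h y1 -> adj h y2 -> adj h y3 -> False.
Proof.
rewrite uniq3E -!val_eqE !cycle_adjE /= => /and3P[].
by have := ltn_ord h; have := ltn_ord y1; have := ltn_ord y2; have := ltn_ord y3; lia.
Qed.

(** This is where [m] must be at least 5, as the cycle on four vertices is a [C_4]; [B 4] is
    evaluated separately. *)
Lemma cycle_noC4 (h h' y y' : H) : h != h' -> y != y' ->
  adj h y -> adj h y' -> adj h' y -> adj h' y' -> False.
Proof.
rewrite -!val_eqE !cycle_adjE /=.
by have := ltn_ord h; have := ltn_ord y; have := ltn_ord h'; have := ltn_ord y'; lia.
Qed.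

End CycleFamily.

Lemma I2_cover (p : 'I_2) : p = ord0 \/ p = ord_max.
Proof. by case: p => [[|[|//]] ?]; [left|right]; apply: val_inj. Qed.

Lemma A_witness0 (G : sgraph) n (u : seq G) : uniq u -> size u = n ->
  (forall x, (forall y, y \in u -> adj x y) -> False) -> A n G 0.
Proof.
move=> uu su H; apply/AP; exists u; split=> //; apply/eqP; rewrite cards_eq0.
by apply/eqP/setP => x; rewrite in_set0; apply/negP => /mem_common/H.
Qed.

Lemma A_witness1 (G : sgraph) n (u : seq G) (z : G) : uniq u -> size u = n ->
  (forall y, y \in u -> adj z y) ->
  (forall x, (forall y, y \in u -> adj x y) -> x = z) -> A n G 1.
Proof.
move=> uu su Hz H; apply/AP; exists u; split=> //; rewrite -(cards1 z).
apply: eq_card => x; rewrite in_set1; apply/mem_common/eqP => [/H //|-> //].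
Qed.

Section BipyramidFamily.
Variable H : sgraph.
Let G := join H (empty_graph 2).
Let neqp : (ord0 : empty_graph 2) != ord_max := isT.
Hypothesis subcubicH : forall h y1 y2 y3 : H, uniq [:: y1; y2; y3] ->
  adj h y1 -> adj h y2 -> adj h y3 -> False.
Hypothesis noC4 : forall h h' y y' : H, h != h' -> y != y' ->
  adj h y -> adj h y' -> adj h' y -> adj h' y' -> False.
Hypothesis H5 : 4 < #|H|.
Variables (h0 h1 h2 : H).
Hypotheses (h01 : adj h0 h1) (h12 : adj h1 h2) (h02 : h0 != h2).
Hypothesis no01 : forall x : H, adj x h0 -> adj x h1 -> False.
Hypothesis only02 : forall x : H, adj x h0 -> adj x h2 -> x = h1.

Lemma pole_common (x : G) p : adj x (inr p) -> exists h : H, x = inl h.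
Proof. by case: x => // h; exists h. Qed.

(** The poles are not adjacent here, so a common neighbour of a pole and the edge [h0 h1] would lie
    in [H], where that edge has no common neighbour. *)
Lemma bipyramid_A3_0 : A 3 G 0.
Proof.
apply: (@A_witness0 G 3 [:: inr ord0; inl h0; inl h1]) => //.
  by rewrite uniq3E (inj_eq (@inl_inj _ _)) (adj_neq h01).
move=> x Hx; have [|h e] := @pole_common x ord0; first by apply: Hx; rewrite inE eqxx.
subst x; apply: (@no01 h); [apply: (Hx (inl h0))|apply: (Hx (inl h1))];
  by rewrite !inE eqxx ?orbT.
Qed.

Lemma bipyramid_A3_1 : A 3 G 1.
Proof.
apply: (@A_witness1 G 3 [:: inr ord0; inl h0; inl h2] (inl h1)) => //.
- by rewrite uniq3E (inj_eq (@inl_inj _ _)) h02.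
- by apply: all3; rewrite //= adj_sym.
- move=> x Hx; have [|h e] := @pole_common x ord0; first by apply: Hx; rewrite inE eqxx.
  subst x; congr inl; apply: only02; [apply: (Hx (inl h0))|apply: (Hx (inl h2))];
    by rewrite !inE eqxx ?orbT.
Qed.

Lemma bipyramid_A4_1 : A 4 G 1.
Proof.
apply: (@A_witness1 G 4 [:: inr ord0; inr ord_max; inl h0; inl h2] (inl h1)) => //.
- by rewrite /= !inE (inj_eq (@inl_inj _ _)) h02.
- by apply: all4; rewrite //= adj_sym.
- move=> x Hx; have [|h e] := @pole_common x ord0; first by apply: Hx; rewrite inE eqxx.
  subst x; congr inl; apply: only02; [apply: (Hx (inl h0))|apply: (Hx (inl h2))];
    by rewrite !inE eqxx ?orbT.
Qed.

(** If the tuple contains a pole, a common neighbour lies in [H] and, at least three vertices of the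
    tuple being in [H], has too many neighbours there. If it contains no pole, both poles are common
    neighbours. *)
Lemma bipyramid_A_not1 n : 4 < n -> ~ A n G 1.
Proof.
move=> n5 /AP[u [uu su cu]].
have [p pu|none] := pickP [pred p : 'I_2 | (inr p : G) \in u].
  have : 0 < #|common_nbrs u| by rewrite cu.
  rewrite card_gt0 => /set0Pn[x /mem_common Hx].
  have [h e] := pole_common (Hx _ pu); subst x.
  have [y1 [y2 [y3 [un i1 i2 i3]]]] :=
    uniq_inl3 neqp I2_cover uu (leq_trans n5 (eq_leq (esym su))).
  by apply: (subcubicH un (Hx _ i1) (Hx _ i2) (Hx _ i3)).
suff : 1 < #|common_nbrs u| by rewrite cu.
have <- : #|[set (inr ord0 : G); inr ord_max]| = 2 by rewrite cards2.
apply/subset_leq_card/subsetP => x; rewrite in_set2 => /orP[]/eqP->; rewrite inE;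
  apply/allP => -[h|p] // pu; by have := none p; rewrite /= pu.
Qed.

Lemma card_bipyramid : #|G| = #|H| + 2.
Proof. exact: (card_join2 _ neqp I2_cover). Qed.

Lemma bipyramid_A_le2 n a : 2 < n -> A n G a -> a <= 2.
Proof.
apply: A_le2.
exact: (@join2_K33_free H (empty_graph 2) _ _ I2_cover subcubicH noC4).
Qed.

Lemma bipyramid_A2 n : 2 < n <= #|H| -> A n G 2.
Proof.
exact: (A2_join2 neqp I2_cover subcubicH noC4).
Qed.

Lemma bipyramid_A :
  [/\ forall n a, 3 <= n <= 4 -> A n G a <-> a <= 2,
      forall n a, 5 <= n <= #|H| -> A n G a <-> a = 0 \/ a = 2
    & forall n a, #|H| < n <= #|H| + 2 -> A n G a <-> a = 0].
Proof.
have A0 n : 3 <= n <= #|H| + 2 -> A n G 0.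
  by rewrite -card_bipyramid => nn; apply: (A0_mono bipyramid_A3_0).
split=> n a nn; (split; first move=> Aa).
- by apply: (bipyramid_A_le2 _ Aa); lia.
- case: a => [|[|[|//]]] _; first by apply: A0; lia.
    have [->|->] : n = 3 \/ n = 4 by lia.
      exact: bipyramid_A3_1.
    exact: bipyramid_A4_1.
  by apply: bipyramid_A2; lia.
- have a2 : a <= 2 by apply: (bipyramid_A_le2 _ Aa); lia.
  by case: a a2 Aa => [|[|[|//]]] _ Aa; [left|case: (@bipyramid_A_not1 n _ Aa)|right]; lia.
- by case=> ->; [apply: A0|apply: bipyramid_A2]; lia.
- have a2 : a <= 2 by apply: (bipyramid_A_le2 _ Aa); lia.
  (* Now [a + n <= #|H| + 2] with [#|H| < n] leaves no room for [a = 2]. *)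
  have := A_bound Aa; rewrite card_bipyramid => b.
  by case: a a2 Aa b => [|[|[|//]]] _ Aa b //; [case: (@bipyramid_A_not1 n _ Aa)|]; lia.
- by move->; apply: A0; lia.
Qed.

End BipyramidFamily.

Lemma A_bipyramid l (G : sgraph) : 4 < l -> G = B l \/ G = B' l ->
  [/\ forall n a, 3 <= n <= 4 -> A n G a <-> a <= 2,
      forall n a, 5 <= n <= l -> A n G a <-> a = 0 \/ a = 2
    & forall n a, l < n <= l.+2 -> A n G a <-> a = 0].
Proof.
move=> l5; have [l0 [l1 l2]] : [/\ 0 < l, 1 < l & 2 < l] by split; lia.
pose h0 := Ordinal l0; pose h1 := Ordinal l1; pose h2 := Ordinal l2.
case=> ->.
- have := @bipyramid_A (cycle_graph l) (@cycle_subcubic _ l5) (@cycle_noC4 _ l5).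
  rewrite (card_ord l : #|cycle_graph l| = l) addn2.
  move=> /(_ l5 h0 h1 h2); apply=> //.
  + by rewrite cycle_adjE.
  + by rewrite cycle_adjE.
  + by move=> x; rewrite !cycle_adjE //=; have := ltn_ord x; lia.
  + move=> x; rewrite !cycle_adjE //= => a b; apply: val_inj => /=.
    by have := ltn_ord x; lia.
- have := @bipyramid_A (path_graph l) (@path_subcubic l) (@path_noC4 l).
  rewrite (card_ord l : #|path_graph l| = l) addn2.
  move=> /(_ l5 h0 h1 h2); apply=> //.
  + by move=> x; rewrite /= /path_adj /=; have := ltn_ord x; lia.
  + move=> x; rewrite /= /path_adj /= => a b; apply: val_inj => /=.
    by have := ltn_ord x; lia.
Qed.

Section TFamily.
Variable m : nat.
Hypothesis m3 : 2 < m.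
Let H := path_graph m.
Let K := complete_graph 2.
Let G := T m.
Let neqp : (ord0 : K) != ord_max := isT.

Lemma card_T : #|G| = m.+2.
Proof. by rewrite (card_join2 H neqp I2_cover) card_ord addn2. Qed.

Lemma T_A_le2 n a : 2 < n -> A n G a -> a <= 2.
Proof.
apply: A_le2.
exact: (@join2_K33_free H K _ _ I2_cover (@path_subcubic m) (@path_noC4 m)).
Qed.

(** A pole missing from the triple is adjacent to all of it, the poles being adjacent in [T]. A
    triple with both poles has a single path vertex, and any path neighbour of that vertex is common
    to all three. *)
Lemma T_A3_not0 : ~ A 3 G 0.
Proof.
case/AP=> -[|x1 [|x2 [|x3 [|x4 u]]]] [uu //= _ /eqP]; rewrite cards_eq0.
move=> /eqP c0; suff [z Hz] : exists z : G, forall y, y \in [:: x1; x2; x3] -> adj z y.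
  by have := in_set0 z; rewrite -c0; move/mem_common: Hz ->.
have pole (p : K) : (inr p : G) \notin [:: x1; x2; x3] -> exists z : G,
    forall y, y \in [:: x1; x2; x3] -> adj z y.
  move=> np; exists (inr p) => -[//|q] qu.
  by rewrite /=; apply: contraNneq np => ->.
have [i0|] := boolP ((inr ord0 : G) \in [:: x1; x2; x3]); last exact: pole.
have [i1|] := boolP ((inr ord_max : G) \in [:: x1; x2; x3]); last exact: pole.
have inl1 (h h' : H) : inl h \in [:: x1; x2; x3] -> inl h' \in [:: x1; x2; x3] -> h = h'.
  move=> ih ih'; apply/eqP; apply: contraTT (leqnn 3) => hh.
  have un : uniq [:: (inl h : G); inl h'; inr ord0; inr ord_max].
    by rewrite /= !inE (inj_eq (@inl_inj _ _)) (negbTE hh).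
  have sub : {subset [:: (inl h : G); inl h'; inr ord0; inr ord_max]
      <= [:: x1; x2; x3]} by apply: all4.
  by have := uniq_leq_size un sub.
case: (@two_of_three H K _ _ I2_cover _ _ _ uu) => [[h [h' [hh ih ih']]]|[h [ih _ _]]].
  by rewrite (inl1 _ _ ih ih') eqxx in hh.
have [h' hh'] : exists h' : H, adj h' h.
  have := ltn_ord h; case: (posnP h) => h0 hm.
    by exists (Ordinal (leq_trans (isT : 1 < 3) m3)); rewrite /= /path_adj /= h0 orbT.
  have h1 : h.-1 < m by lia.
  by exists (Ordinal h1); rewrite /= /path_adj /= prednK // eqxx.
by exists (inl h') => -[k|q] // ik; rewrite (inl1 k h).
Qed.

Lemma T_A : 
  [/\ forall a, A 3 G a <-> a = 1 \/ a = 2,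
      forall n a, 4 <= n <= m -> A n G a <-> a <= 2,
      forall a, A m.+1 G a <-> a <= 1
    & forall a, A m.+2 G a <-> a = 0].
Proof.
have [l0 l1] : 0 < m /\ 1 < m by lia.
pose h0 : H := Ordinal l0; pose h1 : H := Ordinal l1; pose h2 : H := Ordinal m3.
have A40 : A 4 G 0.
  apply: (@A_witness0 G 4 [:: inr ord0; inr ord_max; inl h0; inl h1]) => // x Hx.
  have [||h e] := @no_common_pole H K ord0 ord_max I2_cover x;
    try by apply: Hx; rewrite !inE.
  have := Hx (inl h0); have := Hx (inl h1); rewrite e !inE /= => /(_ isT) + /(_ isT).
  by rewrite /path_adj /=; lia.
have A0 n : 4 <= n <= m.+2 -> A n G 0.
  by rewrite -card_T => nn; apply: (A0_mono A40).
(* A vertex adjacent to both poles lies on the path, and the end [h0] of the path has [h1] as its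
   only path neighbour. *)
have A31 : A 3 G 1.
  apply: (@A_witness1 G 3 [:: inr ord0; inr ord_max; inl h0] (inl h1)) => //.
    by apply: all3.
  move=> x Hx.
  have [||h e] := @no_common_pole H K ord0 ord_max I2_cover x;
    try by apply: Hx; rewrite !inE.
  have := Hx (inl h0); rewrite e !inE /= => /(_ isT).
  by rewrite /path_adj /= => ?; congr inl; apply: val_inj => /=; lia.
(* A pole and [n - 1 >= 3] path vertices: no path vertex has three neighbours on the path, which
   leaves the other pole. *)
have A1 n : 4 <= n <= m.+1 -> A n G 1.
  case/andP=> n4 nm; pose s := take n.-1 (enum H).
  have ss : size s = n.-1 by rewrite size_takel // -cardE card_ord; lia.
  have us : uniq s by rewrite take_uniq ?enum_uniq.
  apply: (@A_witness1 G n (inr ord0 :: [seq inl h | h <- s]) (inr ord_max)).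
  - rewrite /= map_inj_uniq ?us ?andbT; last by move=> ? ? [].
    by apply/negP; case/mapP.
  - by rewrite /= size_map ss prednK //; lia.
  - by move=> y; rewrite inE => /orP[/eqP->|/mapP[h _ ->]].
  - move=> [h|p] Hx; last first.
      by case: (I2_cover p) Hx => -> // /(_ (inr ord0)); rewrite inE eqxx => /(_ isT).
    have Hs y : y \in s -> adj h y.
      by move=> ys; apply: (Hx (inl y)); rewrite inE map_f ?orbT.
    case: s ss us Hs {Hx} => [|y1 [|y2 [|y3 s]]] ss us Hs; move: ss => /=; try lia.
    move=> _; have [] := @path_subcubic m h y1 y2 y3;
      try by apply: Hs; rewrite !inE eqxx ?orbT.
    by move: us; rewrite uniq3E /= !inE !negb_or => /and4P[/and3P[-> -> _] /andP[-> _]].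
have A2 n : 3 <= n <= m -> A n G 2.
  move=> nn; apply: (A2_join2 neqp I2_cover (@path_subcubic m) (@path_noC4 m)).
  by rewrite card_ord.
split=> [a|n a nn|a|a]; (split; first move=> Aa).
- have := T_A_le2 (isT : 2 < 3) Aa.
  by case: a Aa => [/T_A3_not0 []|[|[|//]]]; auto.
- by case=> ->; [exact: A31|apply: A2; lia].
- by apply: T_A_le2 Aa; lia.
- by case: a => [|[|[|//]]] _; [apply: A0|apply: A1|apply: A2]; lia.
- by have := A_bound Aa; rewrite card_T; lia.
- by case: a => [|[|//]] _; [apply: A0|apply: A1]; lia.
- by have := A_bound Aa; rewrite card_T; lia.
- by move=> ->; apply: A0; lia.
Qed.

End TFamily.

(** * Polyhedra where no n vertices have a unique common neighbour *)

Section CompleteBipartite.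
Variable G : sgraph.

Lemma L_common (l : nat) : 0 < l <= L G ->
  exists u v : G, u != v /\ l <= #|common_nbrs [:: u; v]|.
Proof.
case/andP=> l0 lL.
have [k [lk [f [finj fadj]]]] : exists k, l <= k /\ contains G (K2l k).
  apply: contrapT => none; suff : L G <= l.-1 by lia.
  apply/bigmax_leqP => k /asboolP ck; rewrite leqNgt; apply/negP => lk.
  by apply: none; exists k; split=> //; lia.
exists (f (inl ord0)), (f (inl ord_max)); split.
  by apply/eqP => /finj[].
apply: leq_trans lk _; rewrite -[X in X <= _](card_ord k).
have ginj : injective (fun j : 'I_k => f (inr j)) by move=> i j /finj[].
rewrite -(card_imset _ ginj); apply/subset_leq_card/subsetP => x /imsetP[j _ ->].
by apply/mem_common => y; rewrite !inE => /orP[]/eqP->; apply: fadj.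
Qed.

Lemma common_L (u v : G) l : u != v -> l <= #|common_nbrs [:: u; v]| -> l <= L G.
Proof.
move=> uv lc.
have [S SC cS] := exists_subset lc.
have cont : contains G (K2l l).
  pose e (j : 'I_l) : G := nth u (enum S) j.
  have szS : size (enum S) = l by rewrite -cardE.
  have eS j : e j \in S by rewrite -mem_enum mem_nth ?szS.
  pose f (t : K2l l) : G :=
    match t with inl i => if i == ord0 then u else v | inr j => e j end.
  have fe (i : 'I_2) j : adj (f (inl i)) (e j).
    have := subsetP SC _ (eS j); move/mem_common => h.
    by rewrite adj_sym; apply: h; rewrite /= !inE; case: (i == _); rewrite eqxx ?orbT.
  exists f; split; last first.
    by move=> [i|i] [j|j] //= _; [exact: fe | rewrite adj_sym; exact: fe].
  move=> [i|i] [j|j].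
  - case: i j => [[|[|//]] ?] [[|[|//]] ?] //= E; try by congr inl; apply: val_inj.
      by rewrite E eqxx in uv.
    by rewrite E eqxx in uv.
  - by move=> E; have := fe i j; rewrite E adj_irr.
  - by move=> E; have := fe j i; rewrite -E adj_irr.
  - move=> /eqP; rewrite /= /e nth_uniq ?szS ?enum_uniq // => /eqP E.
    by congr inr; apply: val_inj.
have lG : l < #|G|.+1 by have := contains_K2l_bound cont; lia.
have := @leq_bigmax_cond _ (fun k : 'I_#|G|.+1 => `[< contains G (K2l k) >])
  (fun k => k) (Ordinal lG).
by apply; apply/asboolP.
Qed.

End CompleteBipartite.

Section NoUniqueCommonNeighbor.
Variables (R : realType) (G : sgraph).
Hypotheses (planarG : planar R G) (tcG : three_connected G).
Implicit Types (S : {set G}) (v w x : G).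

Lemma planar_K33_free : K33_free G.
Proof.
move=> x1 x2 x3 y1 y2 y3 ux uy H.
have [h11 h12 h13] := H x1 (mem_head _ _).
have [h21 h22 h23] := H x2 ltac:(by rewrite !inE eqxx orbT).
have [h31 h32 h33] := H x3 ltac:(by rewrite !inE eqxx !orbT).
by apply: (@no_K33_sub _ _ planarG x1 x2 x3 y1 y2 y3) => //; apply: all3.
Qed.

Definition shared k v := forall S, S \subset nbrs v -> #|S| = k ->
  exists2 w, w != v & S \subset nbrs w.

Lemma not_A1_shared n : ~ A n G 1 -> forall v, shared n v.
Proof.
move=> nA v S Sv Sn.
have [[w [wv wS]]|none] := pselect (exists w, w != v /\ w \in common_nbrs (enum S)).
  exists w => //; apply/subsetP => x xS; rewrite inE.
  by move/mem_common: wS; apply; rewrite mem_enum.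
case: nA; apply/AP; exists (enum S); rewrite enum_uniq -cardE Sn; split=> //.
rewrite -(cards1 v); apply: eq_card => w; rewrite in_set1; apply/idP/eqP => [wS|->].
  by apply: contrapT => /eqP wv; apply: none; exists w.
by apply/mem_common => x; rewrite mem_enum => /(subsetP Sv); rewrite inE.
Qed.

(** Fix a [k]-set of neighbours of [v] and a second vertex [w] adjacent to all of it. Exchanging one
    element for a further neighbour [x] of [v] gives a vertex [w1]; the [k - 1] remaining elements
    are adjacent to [v], [w] and [w1], and three of them force [w1 = w], so [w] is adjacent to [x].
    For [k = 3] the overlap is too small, hence the separate condition. *)
Lemma shared_twin k v : 2 < k <= #|nbrs v| -> (k = 3 -> #|nbrs v| = 3) ->
  shared k v -> exists2 w, w != v & nbrs v \subset nbrs w.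
Proof.
case/andP=> k3 kv k3v sh.
have [eqk|neqk] := eqVneq k #|nbrs v|; first exact: (sh _ (subxx _) (esym eqk)).
have {k3 k3v neqk kv} [k4 kv] : 3 < k /\ k <= #|nbrs v|.
  by split=> //; move: neqk; have [/k3v->|] := eqVneq k 3; lia.
have [S0 S0v S0k] := exists_subset kv.
have [w wv S0w] := sh S0 S0v S0k.
exists w => //; apply/subsetP => x xv.
have [xS0|xS0] := boolP (x \in S0); first exact: (subsetP S0w).
have [y yS0] : exists y, y \in S0 by apply/set0Pn; rewrite -card_gt0; lia.
pose S1 := x |: (S0 :\ y).
have c1 : #|S0 :\ y| = k.-1 by have := cardsD1 y S0; rewrite yS0; lia.
have S1k : #|S1| = k by rewrite cardsU1 !inE (negbTE xS0) andbF c1; lia.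
have S1v : S1 \subset nbrs v.
  by rewrite subUset sub1set xv; apply: subset_trans (subD1set _ _) S0v.
have [w1 w1v S1w] := sh S1 S1v S1k.
have [<-|ww] := eqVneq w1 w; first by apply: (subsetP S1w); rewrite !inE eqxx.
have : 2 < #|S0 :\ y| by rewrite c1 -ltnS prednK // (ltn_trans _ k4).
case/card_gt2P=> y1 [y2 [y3 [[i1 i2 i3] [n12 n23 n31]]]].
have H z : z \in S0 :\ y -> [/\ adj z v, adj z w & adj z w1].
  move=> zS; have zS0 := subsetP (subD1set _ _) _ zS.
  have zS1 : z \in S1 by rewrite in_setU zS orbT.
  have := subsetP S0v _ zS0; have := subsetP S0w _ zS0; have := subsetP S1w _ zS1.
  by rewrite !inE ![adj z _]adj_sym => -> -> ->.
case: (@planar_K33_free y1 y2 y3 v w w1).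
- by rewrite uniq3E n12 n23 eq_sym n31.
- by rewrite uniq3E eq_sym wv eq_sym w1v eq_sym ww.
- by apply: all3; apply: H.
Qed.

Section Three.
Hypothesis sh3 : forall v, shared 3 v.

Lemma shared3 v x y z : uniq [:: x; y; z] -> adj v x -> adj v y -> adj v z ->
  exists w, [/\ w != v, adj w x, adj w y & adj w z].
Proof.
move=> un vx vy vz; have [||w wv Sw] := @sh3 v [set t in [:: x; y; z]].
- by apply/subsetP => t; rewrite inE => h; rewrite inE; move: t h; apply: all3.
- by rewrite cardsE (card_uniqP un).
exists w; split=> //.
- by have := subsetP Sw x; rewrite !inE eqxx => /(_ isT).
- by have := subsetP Sw y; rewrite !inE eqxx ?orbT => /(_ isT).
- by have := subsetP Sw z; rewrite !inE eqxx ?orbT => /(_ isT).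
Qed.

(* Descent: a vertex [w] stacked on the triangle [abc] of a [K_4] yields a [K_4]
   with a vertex stacked on a triangle in a strictly smaller component. *)
Lemma K4_descent k (a b c d w : G) : uniq [:: a; b; c; d] ->
  adj a b -> adj a c -> adj a d -> adj b c -> adj b d -> adj c d ->
  w \notin [set a; b; c; d] -> adj w a -> adj w b -> adj w c ->
  #|component [set a; b; c; d] w| <= k -> False.
Proof.
elim: k a b c d w => [|k IH] a b c d w un ab ac ad bc bd cd wK wa wb wc Ck.
  have := component_refl [set a; b; c; d] w.
  by move: Ck; rewrite leqn0 cards_eq0 => /eqP->; rewrite inE.
set K := [set a; b; c; d] in wK Ck *; set C := component K w in Ck *.
have wC : w \in C by apply: component_refl.
have nK t : t \in [:: a; b; c; d] -> t \notin C.
  move=> ti; apply/negP => /(component_notin wK); apply/negP/negPn.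
  by move: ti; rewrite !inE -!orbA.
(* [C] already touches [a], [b] and [c], so touching [d] too would give a [K_5] minor. *)
have dC y : y \in C -> ~~ adj y d.
  move=> yC; apply/negP => yd.
  apply: (@no_K5 _ _ planarG C a b c d) => //; first exact: component_connected.
  move=> t ti; split; first exact: nK.
  move: t ti; apply: all4; [exact: component_touch wK wC wa
    |exact: component_touch wK wC wb|exact: component_touch wK wC wc
    |exact: component_touch wK yC yd].
have [ca cb cw] : [/\ adj c a, adj c b & adj c w] by rewrite ![adj c _]adj_sym.
have wn : [/\ w != a, w != b & w != c] by rewrite !adj_neq.
case: wn => wna wnb wnc.
have abn : a != b by rewrite adj_neq.
(* The next stacked vertex is a common neighbour of [a], [b], [w] other than [c]. It is not [d] by
   [dC], so as a neighbour of [w] it lies in [C]. *)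
have [|x [xc xa xb xw]] := @shared3 c a b w _ ca cb cw.
  by rewrite uniq3E abn ![_ == w]eq_sym wna wnb.
have xd : x != d by apply: contraTneq xw => ->; rewrite adj_sym dC.
have [xna xnb xnw] : [/\ x != a, x != b & x != w] by rewrite !adj_neq.
have xK : x \notin K by rewrite !inE !negb_or xna xnb xc xd.
have aw : adj a w by rewrite adj_sym.
have bw : adj b w by rewrite adj_sym.
apply: (IH a b w c x) => //; rewrite 1?adj_sym //.
- move: un; rewrite /= !inE !negb_or ![_ == w]eq_sym wna wnb wnc.
  by case/and4P=> /and3P[-> -> _] /andP[-> _].
- by rewrite !inE !negb_or xna xnb xnw xc.
set K' := [set a; b; w; c].
(* Passing from [K] to [K'] releases only [d], which has no neighbour in [C], and takes [w] out of
   the component. *)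
have sub : component K' x \subset C :\ w.
  apply/subsetP => y; move: y; apply: component_ind.
    by rewrite in_setD1 xnw (component_closed wK wC _ xK) // adj_sym.
  move=> y z; rewrite in_setD1 => /andP[_ yC] _ zK' yz; rewrite in_setD1.
  rewrite !inE !negb_or in zK'; case/andP: zK' => /andP[/andP[za zb] zw] zc.
  apply/andP; split=> //; apply: (component_closed wK yC yz).
  rewrite !inE !negb_or za zb zc /=.
  by apply: contraTneq yz => ->; apply: dC.
apply: leq_trans (subset_leq_card sub) _.
by move: Ck; rewrite (cardsD1 w C) wC.
Qed.

Lemma shared3_K4_free (a b c d : G) :
  adj a b -> adj a c -> adj a d -> adj b c -> adj b d -> adj c d -> False.
Proof.
move=> ab ac ad bc bd cd.
have un : uniq [:: a; b; c; d] by rewrite /= !inE !negb_or !adj_neq.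
have da : adj d a by rewrite adj_sym.
have db : adj d b by rewrite adj_sym.
have dc : adj d c by rewrite adj_sym.
have [|w [wd wa wb wc]] := @shared3 d a b c _ da db dc.
  by rewrite uniq3E !adj_neq.
apply: (@K4_descent _ a b c d w un) (leqnn _) => //.
by rewrite !inE !negb_or wd !adj_neq.
Qed.

(** The sets [{p}], [{s}], [{q, w3, r}] against [v], [w1], [w2] form a [K_{3,3}] minor; the three
    vertices [w1], [w2], [w3] are distinct by [none]. *)
Lemma shared_triples v (p q r s w1 w2 w3 : G) : uniq [:: p; q; r; s] ->
  (forall x, x \in [:: p; q; r; s] -> adj v x) ->
  (forall w, w != v -> adj w p -> adj w q -> adj w r -> adj w s -> False) ->
  [/\ w1 != v, adj w1 p, adj w1 q & adj w1 s] -> w1 != r ->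
  [/\ w2 != v, adj w2 p, adj w2 r & adj w2 s] -> w2 != q ->
  [/\ w3 != v, adj w3 q, adj w3 r & adj w3 s] -> w3 != p -> False.
Proof.
move=> un vx none [w1v w1p w1q w1s] w1r [w2v w2p w2r w2s] w2q [w3v w3q w3r w3s] w3p.
have vp : adj v p by apply: vx; rewrite !inE eqxx ?orbT.
have vq : adj v q by apply: vx; rewrite !inE eqxx ?orbT.
have vr : adj v r by apply: vx; rewrite !inE eqxx ?orbT.
have vs : adj v s by apply: vx; rewrite !inE eqxx ?orbT.
have n12 : w1 != w2 by apply/negP => /eqP e; apply: (none w1) => //; rewrite e.
have n13 : w1 != w3 by apply/negP => /eqP e; apply: (none w1) => //; rewrite e.
have n23 : w2 != w3 by apply/negP => /eqP e; apply: (none w2) => //; rewrite e.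
move: un; rewrite /= !inE !negb_or => /and4P[/and3P[pq pr ps] /andP[qr qs] rs _].
pose C := [set q; w3; r].
have qw3 : adj q w3 by rewrite adj_sym.
have toq x : x \in C -> connect (adj_in C) w3 x.
  rewrite !inE => /orP[/orP[]|] /eqP-> //; apply: connect1;
    by rewrite /adj_in /= !inE !eqxx ?orbT.
have cC : connected_in C.
  by move=> x y /toq hx /toq hy; apply: connect_trans hy; rewrite adj_in_sym.
apply: (@no_K33_set _ _ planarG p s C v w1 w2) => //.
- by rewrite !inE !negb_or pq pr eq_sym w3p.
- by rewrite !inE !negb_or ![s == _]eq_sym qs rs adj_neq.
- by rewrite uniq3E eq_sym w1v eq_sym w2v.
- apply: all3; split; rewrite 1?adj_sym //.
  + by rewrite !inE !negb_or !(adj_neq vq) (adj_neq vr) eq_sym w3v.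
  + by exists q, v; rewrite !inE eqxx adj_sym.
  + by rewrite !inE !negb_or (adj_neq w1q) n13 w1r.
  + by exists q, w1; rewrite !inE eqxx adj_sym.
  + by rewrite !inE !negb_or w2q n23 adj_neq.
  + by exists r, w2; rewrite !inE eqxx orbT adj_sym.
Qed.

(** Each of [wp], [wq], [wr], [ws] is a second common neighbour of the three vertices other than the
    one it is named after. If [wr = r], then [r] is adjacent to the other three, and a second such
    coincidence would complete a [K_4] with [v]. With at most one coincidence, three of the triples
    fit [shared_triples]. *)
Lemma shared4 v : shared 4 v.
Proof.
move=> S Sv S4; apply: contrapT => none.
have [p [q [r [s [un Se]]]]] : exists p q r s, uniq [:: p; q; r; s] /\ S =i [:: p; q; r; s].
  have := enum_uniq S; have := mem_enum S; move: S4; rewrite cardE.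
  case: (enum S) => [|p [|q [|r [|s [|? ?]]]]] // _ Se un.
  by exists p, q, r, s; split=> // x; rewrite Se.
have vS x : x \in [:: p; q; r; s] -> adj v x.
  by rewrite -Se => /(subsetP Sv); rewrite inE.
have {}none w : w != v -> adj w p -> adj w q -> adj w r -> adj w s -> False.
  move=> wv wp wq wr ws; apply: none; exists w => //; apply/subsetP => x.
  by rewrite Se [_ \in nbrs w]inE; move: x; apply: all4.
have vp : adj v p by apply: vS; rewrite !inE eqxx ?orbT.
have vq : adj v q by apply: vS; rewrite !inE eqxx ?orbT.
have vr : adj v r by apply: vS; rewrite !inE eqxx ?orbT.
have vs : adj v s by apply: vS; rewrite !inE eqxx ?orbT.
have := un; rewrite /= !inE !negb_or => /and4P[/and3P[pq pr ps] /andP[qr qs] rs _].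
have [|wr [wrv wrp wrq wrs]] := @shared3 v p q s _ vp vq vs; first by rewrite uniq3E pq ps qs.
have [|wq [wqv wqp wqr wqs]] := @shared3 v p r s _ vp vr vs; first by rewrite uniq3E pr ps rs.
have [|wp [wpv wpq wpr wps]] := @shared3 v q r s _ vq vr vs; first by rewrite uniq3E qr qs rs.
have [|ws [wsv wsp wsq wsr]] := @shared3 v p q r _ vp vq vr; first by rewrite uniq3E pq pr qr.
have nK4 := shared3_K4_free.
have [e|nr] := eqVneq wr r.
  subst wr; have [e|nq] := eqVneq wq q; first by
    subst wq; apply: (nK4 v p q r); rewrite // adj_sym.
  have [e|np] := eqVneq wp p; first by
    subst wp; apply: (nK4 v q p r); rewrite // adj_sym.
  have [e|ns] := eqVneq ws s; first by
    subst ws; apply: (nK4 v p r s); rewrite // adj_sym.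
  apply: (@shared_triples v p q s r ws wq wp) => //.
  - by rewrite /= !inE !negb_or pq ps pr qs qr eq_sym rs.
  - by move=> x xi; apply: vS; move: xi; rewrite !inE => /or4P[]->; rewrite ?orbT.
  - by move=> w ? ? ? ? ?; apply: (none w).
have [e|nq] := eqVneq wq q.
  subst wq; have [e|np] := eqVneq wp p; first by
    subst wp; apply: (nK4 v p q s); rewrite // adj_sym.
  have [e|ns] := eqVneq ws s; first by
    subst ws; apply: (nK4 v p q s); rewrite // adj_sym.
  apply: (@shared_triples v p r s q ws wr wp) => //.
  - by rewrite /= !inE !negb_or pr ps pq rs eq_sym qr eq_sym qs.
  - by move=> x xi; apply: vS; move: xi; rewrite !inE => /or4P[]->; rewrite ?orbT.
  - by move=> w ? ? ? ? ?; apply: (none w).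
have [e|np] := eqVneq wp p.
  subst wp; have [e|ns] := eqVneq ws s; first by
    subst ws; apply: (nK4 v p q s); rewrite // adj_sym.
  apply: (@shared_triples v q r s p ws wr wq) => //.
  - by rewrite /= !inE !negb_or qr qs rs eq_sym pq eq_sym pr eq_sym ps.
  - by move=> x xi; apply: vS; move: xi; rewrite !inE => /or4P[]->; rewrite ?orbT.
  - by move=> w ? ? ? ? ?; apply: (none w).
by apply: (@shared_triples v p q r s wr wq wp).
Qed.

End Three.

Lemma no_unique_common n : 3 <= n <= L G -> ~ A n G 1 -> exceptional G.
Proof.
case/andP=> n3 nL nA; have sh := not_A1_shared nA.
have n0 : 0 < n <= L G by lia.
have [u [u' [uu nu]]] := L_common n0.
have G0 : 0 < #|G| by apply/card_gt0P; exists u.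
have [v mv] := eq_bigmax (fun x : G => #|nbrs x|) G0.
have vmax x : #|nbrs x| <= #|nbrs v|.
  by rewrite -mv; apply: (leq_bigmax (F := fun x : G => #|nbrs x|)).
have nv : n <= #|nbrs v|.
  apply: leq_trans (vmax u); apply: leq_trans nu _; apply/subset_leq_card/subsetP => x.
  by move/mem_common/(_ u (mem_head _ _)); rewrite inE adj_sym.
(* For [n = 3] and degree at least 4, [shared_twin] is applied with [k = 4], where the exchange
   argument has enough overlap. *)
have [w wv Nvw] : exists2 w, w != v & nbrs v \subset nbrs w.
  have [n4|n4] := ltnP 3 n.
    by apply: (shared_twin _ _ (sh v)); lia.
  have e : n = 3 by lia.
  subst n; have [v4|v4] := ltnP 3 #|nbrs v|.
    by apply: (shared_twin _ _ (@shared4 sh v)); lia.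
  by apply: (shared_twin _ _ (sh v)); lia.
have Nv : nbrs v = nbrs w by apply/eqP; rewrite eqEcard Nvw vmax.
rewrite eq_sym in wv.
(* The vertex [x] raises the maximum degree to at least 4. Degree 4 leaves [B 4] and [B' 4], and in
   the latter some three and some four vertices do have a unique common neighbour. *)
have [iso [x x4]] := twin_structure planarG tcG wv Nv (leq_trans n3 nv).
have v4 := leq_trans x4 (vmax x).
have [v5|v5] := ltnP 4 #|nbrs v|.
  by right; left; exists #|nbrs v|.
have e : #|nbrs v| = 4 by lia.
rewrite e in iso nv; case: iso => [iso|iso]; first by right; right; right; left.
case: nA; rewrite (A_iso _ _ iso).
have [->|->] : n = 3 \/ n = 4 by lia.
  exact: A3_B'4.
exact: A4_B'4.
Qed.

End NoUniqueCommonNeighbor.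

(** * Polyhedra where every three vertices have a common neighbour *)

Definition clique4 (G : sgraph) (K : {set G}) :=
  #|K| = 4 /\ forall x y, x \in K -> y \in K -> x != y -> adj x y.

Lemma clique4_set (G : sgraph) (a b c d : G) :
  adj a b -> adj a c -> adj a d -> adj b c -> adj b d -> adj c d ->
  clique4 [set a; b; c; d].
Proof.
move=> ab ac ad bc bd cd; split.
  have un : uniq [:: a; b; c; d] by rewrite /= !inE !negb_or !adj_neq.
  rewrite -[4]/(size [:: a; b; c; d]) -(card_uniqP un).
  by apply: eq_card => x; rewrite !inE -!orbA.
move=> x y; rewrite !inE -!orbA => /or4P[]/eqP-> /or4P[]/eqP->;
  by rewrite ?eqxx // adj_sym.
Qed.

(* For a plane [K_4], this says that [w] lies in the face opposite to [t]. *)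
Definition has_type (G : sgraph) (K : {set G}) (w t : G) :=
  [&& w \notin K, t \in K & ~~ [exists y in component K w, adj y t]].

Lemma isomorphic_stacked (G : sgraph) (N : seq (seq nat)) (a b c d : G) (ws : seq G) :
  uniq [:: a; b; c; d] -> uniq ws -> size ws = size N ->
  (forall x y, x \in [:: a; b; c; d] -> y \in [:: a; b; c; d] -> x != y -> adj x y) ->
  (forall w, w \in ws -> w \notin [:: a; b; c; d]) ->
  (forall w w', w \in ws -> w' \in ws -> ~~ adj w w') ->
  (forall x, x \notin [:: a; b; c; d] -> x \in ws) ->
  (forall i k, i < 4 -> k < size N ->
     adj (nth a [:: a; b; c; d] i) (nth a ws k) = (i \in nth [::] N k)) ->
  isomorphic G (stackedK4 N).
Proof.
move=> uK uw sw clK wK ww cov ad.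
pose g (t : stackedK4 N) : G :=
  match t with inl i => nth a [:: a; b; c; d] i | inr k => nth a ws k end.
have gK (i : 'I_4) : g (inl i) \in [:: a; b; c; d] by apply: mem_nth.
have gw (k : 'I_(size N)) : g (inr k) \in ws by apply: mem_nth; rewrite sw.
have gi (i j : 'I_4) : (g (inl i) == g (inl j)) = (i == j).
  by rewrite /g nth_uniq.
apply: (@isomorphic_from _ _ g).
- move=> [i|i] [j|j] /eqP.
  + by rewrite gi => /eqP->.
  + by move=> /eqP e; have := wK _ (gw j); rewrite -e gK.
  + by move=> /eqP e; have := wK _ (gw i); rewrite e gK.
  + by rewrite /g nth_uniq ?sw // => /eqP/val_inj->.
- move=> x; have [xK|/cov xw] := boolP (x \in [:: a; b; c; d]).
    have i4 : index x [:: a; b; c; d] < 4 by rewrite -index_mem in xK.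
    by exists (inl (Ordinal i4)); apply: nth_index.
  have iw : index x ws < size N by rewrite -sw index_mem.
  by exists (inr (Ordinal iw)); apply: nth_index.
- move=> [i|i] [j|j].
  + rewrite -[RHS]/(i != j) -gi.
    by have [->|ne] := eqVneq (g (inl i)) (g (inl j)); rewrite ?adj_irr ?clK.
  + by rewrite /= ad.
  + by rewrite adj_sym /= ad.
  + by apply/negbTE/ww.
Qed.

(** * Polyhedra with a dominating edge *)

Section Dominating.
Variables (R : realType) (G : sgraph).
Hypotheses (planarG : planar R G) (tcG : three_connected G).

(** The other vertices induce a path or a cycle. A cycle is impossible: [a], [b], two consecutive
    vertices of it and the contracted rest form a [K_5] minor. *)
Lemma dominating_edge (a b : G) : 4 < #|G| -> adj a b ->
  (forall x, x != a -> x != b -> adj a x /\ adj b x) ->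
  exists m, 3 <= m /\ isomorphic G (T m).
Proof.
move=> G5 ab dom; have anb := adj_neq ab.
pose S := ~: [set a; b].
have domS x : x \in S -> adj a x /\ adj b x.
  by rewrite !inE negb_or => /andP[xa xb]; apply: dom.
have cS : #|S| = #|G| - 2 by rewrite cardsCs setCK cards2 anb.
have [x0 x0S] : exists x, x \in S by apply/set0Pn; rewrite -card_gt0; lia.
have conS : connected_in S by apply: connected_setC; rewrite // cards2 anb.
have [s [us sS sl]] := path_or_cycle x0S conS (subcubic_poles planarG anb domS).
have szs : size s = #|S| by rewrite -(card_uniqP us); apply: eq_card.
have sz3 : 2 < size s by rewrite szs; lia.
have sadj x : x \in s -> adj a x /\ adj b x by rewrite sS; apply: domS.
have scov x : [|| x \in s, x == a | x == b].
  by rewrite sS !inE; case: (x == a); case: (x == b).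
case: sl => [pl|[_ cl]].
  by exists (size s); split=> //; apply: isomorphic_T us anb sadj scov pl ab.
exfalso.
pose y i := nth a s i.
have yS i : i < size s -> y i \in s by move=> ?; apply: mem_nth.
have yU i j : i < size s -> j < size s -> (y i == y j) = (i == j).
  by move=> ? ?; apply: nth_uniq.
have s0 : 0 < size s by apply: leq_trans sz3.
have s1 : 1 < size s by apply: leq_trans sz3.
have ySucc i : i.+1 < size s -> adj (y i) (y i.+1).
  move=> h; rewrite cl // ?(ltnW h) // (modn_small h) eqxx /=.
  by rewrite neq_ltn ltnSn.
have yLast : adj (y (size s).-1) (y 0).
  have h : (size s).-1 < size s by rewrite prednK.
  by rewrite cl // prednK // modnn eqxx andbT -lt0n -ltnS prednK.
pose C := [set x in drop 2 s].
have CP x : reflect (exists2 i, 1 < i < size s & y i = x) (x \in C).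
  rewrite inE; apply: (iffP (nthP a)) => [[i]|[i /andP[i1 i2] <-]].
    rewrite size_drop nth_drop => h <-; exists (2 + i) => //.
    by rewrite ltn_addr //= -ltn_subRL.
  exists (i - 2); first by rewrite size_drop ltn_sub2r.
  by rewrite nth_drop subnKC.
have toC i : 1 < i < size s -> connect (adj_in C) (y 2) (y i).
  elim: i => // i IH /andP[]; rewrite ltnS leq_eqVlt => /orP[/eqP<- //|i2 h].
  have i1 : 1 < i < size s by rewrite i2 ltnW.
  apply: connect_trans (IH i1) _; apply: connect1; rewrite /adj_in /= ySucc // andbT.
  by apply/andP; split; apply/CP; [exists i|exists i.+1; rewrite ?h ?ltnS ?(ltnW i2)].
have conC : connected_in C.
  move=> u v /CP[i hi <-] /CP[j hj <-]; apply: connect_trans (toC _ hj).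
  by rewrite adj_in_sym; apply: toC.
have out x : x \notin s -> x \notin C.
  by apply: contraNN => /CP[i /andP[_ hi] <-]; apply: yS.
have as_ : a \notin s by rewrite sS !inE eqxx.
have bs : b \notin s by rewrite sS !inE eqxx orbT.
have C2 : y 2 \in C by apply/CP; exists 2; rewrite ?sz3.
have CL : y (size s).-1 \in C.
  by apply/CP; exists (size s).-1 => //; rewrite -ltnS !prednK ?sz3 //=; lia.
have [ay0 by0] := sadj _ (yS _ s0); have [ay1 by1] := sadj _ (yS _ s1).
have [ay2 by2] := sadj _ (yS _ sz3).
apply: (@no_K5 _ _ planarG C a b (y 0) (y 1)) => //.
- by rewrite /= !inE !negb_or anb !adj_neq // ySucc.
- apply: all4; split.
  + exact: out.
  + by exists (y 2), a; rewrite C2 inE eqxx adj_sym.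
  + exact: out.
  + by exists (y 2), b; rewrite C2 inE eqxx adj_sym.
  + by apply/negP => /CP[i /andP[i1 hi] /eqP]; rewrite yU // => /eqP e; rewrite e in i1.
  + by exists (y (size s).-1), (y 0); rewrite CL inE eqxx.
  + by apply/negP => /CP[i /andP[i1 hi] /eqP]; rewrite yU // => /eqP e; rewrite e in i1.
  + by exists (y 2), (y 1); rewrite C2 inE eqxx adj_sym ySucc.
- exact: ySucc.
Qed.

End Dominating.

(** * Components outside a [K_4] and their types *)

Section EveryTriple.
Variables (R : realType) (G : sgraph).
Hypotheses (planarG : planar R G) (tcG : three_connected G).
Implicit Types (K : {set G}) (x y w t : G).

Section Types.
Variable K : {set G}.
Hypothesis K4 : clique4 K.

Let adjK x y : x \in K -> y \in K -> x != y -> adj x y.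
Proof. by case: K4 => _; apply. Qed.

Let card3 t : t \in K -> #|K :\ t| = 3.
Proof. by move=> tK; have := cardsD1 t K; rewrite tK; case: K4 => -> _ []. Qed.

Lemma clique4_not_all_touched w : w \notin K ->
  (forall t, t \in K -> touch (component K w) [set t]) -> False.
Proof.
move=> wK tch; have [cK _] := K4.
have [a [b [c [d [un Ke]]]]] :
    exists a b c d, uniq [:: a; b; c; d] /\ K =i [:: a; b; c; d].
  have := enum_uniq K; have := mem_enum K; move: cK; rewrite cardE.
  case: (enum K) => [|a [|b [|c [|d [|? ?]]]]] // _ Ke un.
  by exists a, b, c, d; split=> // x; rewrite Ke.
have [aK bK cK' dK] : [/\ a \in K, b \in K, c \in K & d \in K].
  by rewrite !Ke !inE !eqxx ?orbT.
have := un; rewrite /= !inE !negb_or => /and4P[/and3P[ab ac ad] /andP[bc bd] cd _].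
apply: (@no_K5 _ _ planarG (component K w) a b c d) => //;
  try exact: adjK; first exact: component_connected.
move=> t; rewrite -Ke => tK; split; last exact: tch.
by apply: contraL tK => /(component_notin wK).
Qed.

(** By 3-connectedness the boundary of the component has at least three vertices, and only the three
    of [K :\ t] are available. *)
Lemma type_touch w t s : has_type K w t -> s \in K -> s != t ->
  touch (component K w) [set s].
Proof.
case/and3P=> wK tK nt sK st; set C := component K w.
have tC : t \notin C by apply: contraL tK => /(component_notin wK).
have tB : t \notin boundary C by rewrite inE tC.
have BK : boundary C \subset K :\ t.
  by rewrite subsetD1 tB boundary_component.
have := boundary_ge3 tcG (component_refl K w) tC tB; rewrite -(card3 tK) => B3.
have /eqP BE : boundary C == K :\ t by rewrite eqEcard BK.
have : s \in boundary C by rewrite BE !inE st.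
by rewrite inE => /andP[_ /touch1P].
Qed.

Lemma type_exists w : w \notin K -> exists t, has_type K w t.
Proof.
move=> wK; apply: contrapT => none; apply: (clique4_not_all_touched wK) => t tK.
apply/touch1P; case: (boolP [exists y in _, _]) => // nt.
by case: none; exists t; apply/and3P.
Qed.

Lemma type_notin w t : has_type K w t -> w \notin K /\ t \in K.
Proof. by case/and3P. Qed.

Lemma type_untouched w t x : has_type K w t -> x \in component K w -> ~~ adj x t.
Proof.
case/and3P=> _ _ /exists_inPn h xC; exact: h.
Qed.

Lemma type_uniq w t t' : has_type K w t -> has_type K w t' -> t = t'.
Proof.
move=> wt wt'; have [_ tK] := type_notin wt.
apply/eqP/negPn/negP => tt; have [y [z [yC]]] := type_touch wt' tK tt.
by rewrite inE => /eqP-> yt; have := type_untouched wt yC; rewrite yt.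
Qed.

Lemma type_component w w' t : has_type K w t -> w' \in component K w ->
  has_type K w' t.
Proof.
move=> wt w'C; have [wK tK] := type_notin wt.
have w'K := component_notin wK w'C.
apply/and3P; split=> //; apply/exists_inPn => x.
by rewrite (component_eq w'C); apply: type_untouched wt.
Qed.

(** Two different components of the same type, together with [t], would form a [K_{3,3}] minor with
    the three vertices of [K :\ t]. *)
Lemma type_same_component w w' t : has_type K w t -> has_type K w' t ->
  w' \in component K w.
Proof.
move=> wt wt'; apply/negPn/negP => ww.
have [wK tK] := type_notin wt; have [w'K _] := type_notin wt'.
have : 2 < #|K :\ t| by rewrite card3.
case/card_gt2P=> x1 [x2 [x3 [[i1 i2 i3] [n12 n23 n31]]]].
have notC v x : v \notin K -> x \in K -> x \notin component K v.
  by move=> vK; apply: contraL => /(component_notin vK).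
apply: (@no_K33 _ _ planarG (component K w) (component K w') [set t] x1 x2 x3).
- exact: component_connected.
- exact: component_connected.
- exact: connected_in1.
- rewrite disjoint_subset; apply/subsetP => x xC; rewrite inE; apply/negP => xC'.
  by move: ww; rewrite -(component_eq xC) (component_eq xC') component_refl.
- by rewrite disjoint_sym disjoints1 notC.
- by rewrite disjoint_sym disjoints1 notC.
- by rewrite uniq3E n12 n23 eq_sym n31.
- have H x : x \in K :\ t ->
    [/\ x \notin component K w, x \notin component K w' & x \notin [set t]] /\
    [/\ touch (component K w) [set x], touch (component K w') [set x]
      & touch [set t] [set x]].
    rewrite in_setD1 => /andP[xt xK]; split; split; rewrite ?notC ?inE //.
    + exact: type_touch wt _ _.
    + exact: type_touch wt' _ _.
    + by exists t, x; rewrite !inE; split=> //; apply: adjK; rewrite // eq_sym.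
  by apply: all3; apply: H.
Qed.

Lemma type_adj w t x : has_type K w t -> adj w x -> x \notin K -> has_type K x t.
Proof.
move=> wt wx xK; have [wK _] := type_notin wt.
by apply: type_component wt _; apply: component_closed (component_refl K w) wx xK.
Qed.

End Types.

Hypothesis triple : forall u v w : G, uniq [:: u; v; w] ->
  exists x, [/\ adj x u, adj x v & adj x w].

Lemma other_vertex (s : seq G) : size s < #|G| -> exists x, x \notin s.
Proof.
move=> sG; apply: contrapT => none; move: sG; rewrite ltnNge; case/negP.
apply: leq_trans (card_size s); apply/subset_leq_card/subsetP => x _.
by apply/negPn/negP => xs; apply: none; exists x.
Qed.

(** [triple] is used twice, the second time with the vertex found first, which makes the two common
    neighbours adjacent. *)
Lemma common_edge u v : u != v -> exists x y,
  [/\ adj x y, adj u x, adj u y, adj v x & adj v y].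
Proof.
move=> uv; have [G4 _] := tcG.
have [w] := @other_vertex [:: u; v] (ltn_trans (isT : 2 < 3) G4).
rewrite !inE negb_or => /andP[wu wv].
have [|x [xu xv _]] := @triple u v w; first by rewrite uniq3E uv eq_sym wu eq_sym wv.
have [|y [yu yv yx]] := @triple u v x.
  by rewrite uniq3E uv eq_sym (adj_neq xu) eq_sym (adj_neq xv).
by exists x, y; split; rewrite adj_sym.
Qed.

Section TwoTypes.
Variables (K : {set G}) (w1 w2 t1 t2 : G).
Hypotheses (K4 : clique4 K) (wt1 : has_type K w1 t1) (wt2 : has_type K w2 t2).
Hypothesis t12 : t1 != t2.

(** A common neighbour of [w1] and [w2] lies in [K], since outside [K] it would have both types, and
    it is neither [t1] nor [t2]. By [common_edge] there are two of them, and only two vertices of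
    [K] remain. *)
Lemma two_types_adj s : s \in K -> s != t1 -> s != t2 -> adj w1 s /\ adj w2 s.
Proof.
move=> sK s1 s2; have [w1K t1K] := type_notin wt1; have [w2K t2K] := type_notin wt2.
have w12 : w1 != w2.
  apply/negP => /eqP e; move: wt1; rewrite e => h.
  by move: t12; rewrite (type_uniq K4 h wt2) eqxx.
have [x [y [xy x1 y1 x2 y2]]] := common_edge w12.
have P z : adj w1 z -> adj w2 z -> z \in K :\ t1 :\ t2.
  move=> z1 z2; rewrite !in_setD1; apply/and3P; split.
  - by apply/negP => /eqP e; have := type_untouched wt2 (component_refl K w2); rewrite -e z2.
  - by apply/negP => /eqP e; have := type_untouched wt1 (component_refl K w1); rewrite -e z1.
  - apply/negPn/negP => zK; have := type_uniq K4 (type_adj wt1 z1 zK) (type_adj wt2 z2 zK).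
    by move=> e; move: t12; rewrite e eqxx.
have c2 : #|K :\ t1 :\ t2| = 2.
  have := cardsD1 t1 K; have := cardsD1 t2 (K :\ t1).
  by rewrite t1K in_setD1 eq_sym t12 t2K; case: K4 => -> _ -> [] ->.
have /eqP E : [set x; y] == K :\ t1 :\ t2.
  rewrite eqEcard c2 cards2 (adj_neq xy) andbT.
  by apply/subsetP => z; rewrite !inE -!in_setD1 => /orP[]/eqP->; have := P _ x1 x2;
    have := P _ y1 y2; rewrite !in_setD1.
have : s \in [set x; y] by rewrite E !in_setD1 s1 s2.
by rewrite in_set2 => /orP[]/eqP->.
Qed.

End TwoTypes.

End EveryTriple.

Section EveryTriple.
Variables (R : realType) (G : sgraph).
Hypotheses (planarG : planar R G) (tcG : three_connected G).
Hypothesis triple : forall u v w : G, uniq [:: u; v; w] ->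
  exists x, [/\ adj x u, adj x v & adj x w].
Implicit Types (K : {set G}) (x y w t d a : G).

Section ThreeTypes.
Variables (K : {set G}) (w1 w2 w3 t1 t2 t3 : G).
Hypotheses (K4 : clique4 K) (wt1 : has_type K w1 t1) (wt2 : has_type K w2 t2)
  (wt3 : has_type K w3 t3).
Hypothesis t123 : uniq [:: t1; t2; t3].

Let adjK x y : x \in K -> y \in K -> x != y -> adj x y.
Proof. by case: K4 => _; apply. Qed.

(** For [s] different from [t], one of the three types avoids both, and [two_types_adj] applies with
    a vertex of that type. *)
Lemma three_types_adj w t s : has_type K w t -> s \in K -> adj s w = (s != t).
Proof.
move=> wt sK; have [->|st] := eqVneq s t.
  by rewrite adj_sym; apply/negbTE; apply: type_untouched wt (component_refl _ _).
suff [t' [w' [wt' tt' st']]] : exists t' w', [/\ has_type K w' t', t != t' & s != t'].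
  by rewrite adj_sym; case: (two_types_adj tcG triple K4 wt wt' tt' sK st st').
move: t123; rewrite uniq3E => /and3P[t12 t13 t23].
have [e1|n1] := eqVneq t t1.
  have [e2|n2] := eqVneq s t2; last by exists t2, w2; rewrite wt2 e1 t12.
  by exists t3, w3; rewrite wt3 e1 e2 t13.
have [e1|m1] := eqVneq s t1; last by exists t1, w1; rewrite wt1 n1.
have [e2|n2] := eqVneq t t2; last by exists t2, w2; rewrite wt2 n2 e1 t12.
by exists t3, w3; rewrite wt3 e1 e2 t13.
Qed.

(** Two vertices of type [t] and [t] itself would be adjacent to all of [K :\ t], a [K_{3,3}]. *)
Lemma three_types_inj w w' t : has_type K w t -> has_type K w' t -> w = w'.
Proof.
move=> wt wt'; apply/eqP/negPn/negP => ww.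
have [wK tK] := type_notin wt; have [w'K _] := type_notin wt'.
have c3 : #|K :\ t| = 3.
  by have := cardsD1 t K; rewrite tK; case: K4 => -> _ [].
have : 2 < #|K :\ t| by rewrite c3.
case/card_gt2P=> x1 [x2 [x3 [[i1 i2 i3] [n12 n23 n31]]]].
apply: (@no_K33_sub _ _ planarG w w' t x1 x2 x3).
- rewrite uniq3E ww /=.
  by apply/andP; split; [apply: contraNneq wK => ->|apply: contraNneq w'K => ->].
- by rewrite uniq3E n12 n23 eq_sym n31.
- have H x : x \in K :\ t -> [/\ adj w x, adj w' x & adj t x].
    rewrite in_setD1 => /andP[xt xK]; rewrite ![adj _ x]adj_sym.
    by rewrite (three_types_adj wt) // (three_types_adj wt') // adjK.
  by apply: all3; apply: H.
Qed.

Lemma three_types_independent w w' : w \notin K -> w' \notin K -> ~~ adj w w'.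
Proof.
move=> wK w'K; apply/negP => ww; have [t wt] := type_exists planarG K4 wK.
by have := adj_neq ww; rewrite (three_types_inj wt (type_adj wt ww w'K)) eqxx.
Qed.

Lemma three_types_exceptional : isomorphic G S5 \/ isomorphic G S7.
Proof.
have [w1K t1K] := type_notin wt1; have [w2K t2K] := type_notin wt2.
have [w3K t3K] := type_notin wt3.
have := t123; rewrite uniq3E => /and3P[t12 t13 t23].
have [a aK] : exists a, a \in K :\: [set t1; t2; t3].
  apply/set0Pn; rewrite -card_gt0 cardsD; case: K4 => -> _.
  have sub : #|K :&: [set t1; t2; t3]| <= #|[set t1; t2; t3]|.
    exact: subset_leq_card (subsetIr _ _).
  have c3 : #|[set t1; t2; t3]| <= 3.
    by rewrite -setUA !cardsU1 cards1; case: (_ \notin _); case: (_ \notin _).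
  by rewrite subn_gt0 (leq_ltn_trans sub).
move: aK; rewrite !inE !negb_or => /andP[/andP[/andP[at1 at2] at3] aK].
(* In this order the vertices missed by [w1], [w2], [w3] have the indices 3, 2, 1, as in the lists
   of [S5] and [S7]; a vertex of type [a] supplies the fourth entry of [S7]. *)
have un : uniq [:: a; t3; t2; t1].
  by rewrite /= !inE !negb_or at1 at2 at3 ![t3 == _]eq_sym t13 t23 eq_sym t12.
have KE : K =i [:: a; t3; t2; t1].
  have sub : [set x in [:: a; t3; t2; t1]] \subset K.
    by apply/subsetP => x; rewrite inE; move: x; apply: all4.
  have /eqP E : [set x in [:: a; t3; t2; t1]] == K.
    by rewrite eqEcard sub cardsE (card_uniqP un); case: K4 => ->.
  by move=> x; rewrite -E inE.
have clK x y : x \in [:: a; t3; t2; t1] -> y \in [:: a; t3; t2; t1] -> x != y -> adj x y.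
  by rewrite -!KE; apply: adjK.
have distinct w w' t t' : has_type K w t -> has_type K w' t' -> t != t' -> w != w'.
  move=> wt wt'; apply: contraNneq => e; apply/eqP.
  by apply: (type_uniq tcG K4 wt); rewrite e.
have cover w t : has_type K w t -> [|| w == w1, w == w2, w == w3 | has_type K w a].
  move=> wt; have [_ ] := type_notin wt; rewrite KE !inE => /or4P[]/eqP e;
    move: wt; rewrite e => wt.
  - by rewrite wt !orbT.
  - by rewrite (three_types_inj wt wt3) eqxx !orbT.
  - by rewrite (three_types_inj wt wt2) eqxx !orbT.
  - by rewrite (three_types_inj wt wt1) eqxx.
have n12 := distinct _ _ _ _ wt1 wt2 t12.
have n13 := distinct _ _ _ _ wt1 wt3 t13.
have n23 := distinct _ _ _ _ wt2 wt3 t23.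
have [[wa wta]|none] := pselect (exists wa, has_type K wa a).
  right; have [waK _] := type_notin wta.
  apply: (@isomorphic_stacked _ _ a t3 t2 t1 [:: w1; w2; w3; wa] un) => //.
  - rewrite /= !inE !negb_or n12 n13 n23 /=.
    by rewrite ![_ == wa]eq_sym !(distinct _ _ _ _ wta wt1, distinct _ _ _ _ wta wt2,
      distinct _ _ _ _ wta wt3).
  - by move=> w; rewrite -KE; move: w; apply: all4.
  - have H w : w \in [:: w1; w2; w3; wa] -> w \notin K by move: w; apply: all4.
    by move=> w w' /H wK /H w'K; apply: three_types_independent.
  - move=> x; rewrite -KE => /(type_exists planarG K4)[t /[dup] xt /cover].
    case/or4P=> [/eqP->|/eqP->|/eqP->|xa]; rewrite ?inE ?eqxx ?orbT //.
    by rewrite (three_types_inj xa wta) eqxx !orbT.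
  - move=> [|[|[|[|i]]]] [|[|[|[|k]]]] // _ _ /=;
      rewrite ?(three_types_adj wt1) ?(three_types_adj wt2) ?(three_types_adj wt3)
        ?(three_types_adj wta) ?eqxx // 1?eq_sym ?at1 ?at2 ?at3 ?t12 ?t13 ?t23 //;
      by rewrite eq_sym ?at1 ?at2 ?at3 ?t12 ?t13 ?t23.
left; apply: (@isomorphic_stacked _ _ a t3 t2 t1 [:: w1; w2; w3] un) => //.
- by rewrite uniq3E n12 n13 n23.
- by move=> w; rewrite -KE; move: w; apply: all3.
- have H w : w \in [:: w1; w2; w3] -> w \notin K by move: w; apply: all3.
  by move=> w w' /H wK /H w'K; apply: three_types_independent.
- move=> x; rewrite -KE => /(type_exists planarG K4)[t /[dup] xt /cover].
  case/or4P=> [/eqP->|/eqP->|/eqP->|xa]; rewrite ?inE ?eqxx ?orbT //.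
  by case: none; exists x.
- move=> [|[|[|[|i]]]] [|[|[|k]]] // _ _ /=;
    rewrite ?(three_types_adj wt1) ?(three_types_adj wt2) ?(three_types_adj wt3)
      ?eqxx // 1?eq_sym ?at1 ?at2 ?at3 ?t12 ?t13 ?t23 //;
    by rewrite eq_sym ?at1 ?at2 ?at3 ?t12 ?t13 ?t23.
Qed.

End ThreeTypes.

(** By [two_types_adj] the two vertices of [K] other than [t1] and [t2] see everything outside [K],
    so they form a dominating edge. *)
Lemma two_types_exceptional K w1 w2 t1 t2 : clique4 K ->
  has_type K w1 t1 -> has_type K w2 t2 -> t1 != t2 ->
  (forall w t, has_type K w t -> t = t1 \/ t = t2) ->
  exists m, 3 <= m /\ isomorphic G (T m).
Proof.
move=> K4 wt1 wt2 t12 only.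
have [w1K t1K] := type_notin wt1; have [w2K t2K] := type_notin wt2.
have adjK x y : x \in K -> y \in K -> x != y -> adj x y by case: K4 => _; apply.
have c2 : #|K :\ t1 :\ t2| = 2.
  have := cardsD1 t1 K; have := cardsD1 t2 (K :\ t1).
  by rewrite t1K in_setD1 eq_sym t12 t2K; case: K4 => -> _ -> [] ->.
have /cards2P[a [b [ab E]]] : #|K :\ t1 :\ t2| == 2 by rewrite c2.
have inab s : s \in [set a; b] -> [/\ s != t2, s != t1 & s \in K].
  by rewrite -E !in_setD1 => /and3P.
have [a2 a1 aK] := inab a (set21 _ _); have [b2 b1 bK] := inab b (set22 _ _).
apply: (@dominating_edge _ _ planarG tcG a b); last 1 first.
- move=> x xa xb; have [xK|xK] := boolP (x \in K).
    by rewrite !adjK // eq_sym.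
  have [t xt] := type_exists planarG K4 xK.
  have H s : s \in K -> s != t1 -> s != t2 -> adj s x.
    move=> sK s1 s2; rewrite adj_sym.
    case: (only x t xt) => e; move: xt; rewrite e => xt.
      by case: (two_types_adj tcG triple K4 xt wt2 t12 sK s1 s2).
    by rewrite eq_sym in t12; case: (two_types_adj tcG triple K4 xt wt1 t12 sK s2 s1).
  by rewrite !H.
- have : #|w1 |: K| <= #|G| by apply: max_card.
  by rewrite cardsU1 w1K; case: K4 => ->.
- exact: adjK.
Qed.

(** * Corners and the case of a single type *)

Definition corner (d : G) := #|nbrs d| = 3 /\ clique4 (d |: nbrs d).

Lemma corner_notin d : d \notin nbrs d. Proof. by rewrite inE adj_irr. Qed.

Lemma corner_type d w : corner d -> w \notin d |: nbrs d ->
  has_type (d |: nbrs d) w d.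
Proof.
move=> [d3 K4] wK; have [t wt] := type_exists planarG K4 wK.
have [e|dt] := eqVneq d t; first by move: wt; rewrite -e.
have [y [z [yC]]] := type_touch tcG K4 wt (setU11 _ _) dt.
rewrite inE => /eqP-> yd; have := component_notin wK yC.
by rewrite !inE negb_or [adj d y]adj_sym yd andbF.
Qed.

Lemma corner_outer d w a : corner d -> w \notin d |: nbrs d -> a \in nbrs d ->
  exists2 y, y \notin d |: nbrs d & adj a y.
Proof.
move=> cd wK ad; have wt := corner_type cd wK; have [_ K4] := cd.
have nad : a != d by apply: contraTneq ad => ->; rewrite corner_notin.
have [|y [z [yC]]] := type_touch tcG K4 wt _ nad; first by rewrite inE ad orbT.
rewrite inE => /eqP-> ya; exists y; first exact: component_notin wK yC.
by rewrite adj_sym.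
Qed.

(** A neighbour of a corner is adjacent to the rest of the [K_4] and, by [corner_outer], to an
    outside vertex, so its degree is at least 4. *)
Lemma corner_independent d a : 4 < #|G| -> corner d -> a \in nbrs d -> ~ corner a.
Proof.
move=> G5 cd ad [a3 _]; have [d3 K4] := cd; set K := d |: nbrs d.
have cK : #|K| = 4 by case: K4.
have [w wK] : exists w, w \notin K.
  case: (pickP [pred w | w \notin K]) => [w wK|none]; first by exists w.
  suff : #|G| <= #|K| by rewrite cK leqNgt G5.
  by apply/subset_leq_card/subsetP => x _; have := none x; rewrite /=; case: (x \in K).
have [y yK ay] := corner_outer cd wK ad.
have aK : a \in K by rewrite inE ad orbT.
have : #|y |: (K :\ a)| <= #|nbrs a|.
  apply/subset_leq_card/subsetP => x; rewrite in_setU1 in_setD1 [_ \in nbrs a]inE.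
  case/orP=> [/eqP->//|].
  by case/andP=> xa xK; case: K4 => _; apply; rewrite // eq_sym.
rewrite cardsU1 in_setD1 (negbTE yK) andbF a3.
have c3 : #|K :\ a| = 3 by have := cardsD1 a K; rewrite aK cK => -[].
by rewrite c3.
Qed.

(** All vertices outside the [K_4] of [d] have type [d], hence lie in the component of [d'], which
    is [d'] alone. Then any two neighbours of [d] form a dominating edge. *)
Lemma same_corner d d' : 4 < #|G| -> corner d -> corner d' -> d != d' ->
  nbrs d = nbrs d' -> exists m, 3 <= m /\ isomorphic G (T m).
Proof.
move=> G5 cd cd' dd N; have [d3 K4] := cd; set K := d |: nbrs d.
have d'N : d' \notin nbrs d by rewrite N corner_notin.
have d'K : d' \notin K by rewrite in_setU1 eq_sym negb_or dd.
have d't : has_type K d' d by apply: corner_type.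
have all w : w \notin K -> w = d'.
  move=> wK; have wt := corner_type cd wK.
  have := type_same_component planarG tcG K4 d't wt.
  apply: (@component_ind _ _ _ (fun x => x = d')) => // y z -> _ zK yz.
  by move: zK; rewrite in_setU1 negb_or N inE yz andbF.
have : 1 < #|nbrs d| by rewrite d3.
case/card_gt1P=> a [b [ad bd ab]].
have inK x : x \in nbrs d -> x \in K by move=> xd; rewrite inE xd orbT.
apply: (@dominating_edge _ _ planarG tcG a b) => //.
  by case: K4 => _; apply; rewrite ?inK.
move=> x xa xb; have [xK|/all ->] := boolP (x \in K).
  by case: K4 => _ cl; split; apply: cl => //; rewrite 1?eq_sym //; apply: inK.
by move: ad bd; rewrite N !inE ![adj d' _]adj_sym.
Qed.

Section OneType.
Hypothesis G5 : 4 < #|G|.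
Hypothesis one_type : forall K w w' t t', clique4 K -> has_type K w t ->
  has_type K w' t' -> t = t'.

Lemma clique4_outside K : clique4 K -> exists w, w \notin K.
Proof.
move=> [cK _]; case: (pickP [pred w | w \notin K]) => [w wK|none]; first by exists w.
suff : #|G| <= #|K| by rewrite cK leqNgt G5.
by apply/subset_leq_card/subsetP => x _; have := none x; rewrite /=; case: (x \in K).
Qed.

(** If [d] is the only type, no vertex outside [K] is adjacent to [d], so [d] has degree 3. *)
Lemma clique4_corner K : clique4 K -> exists d, corner d /\ K = d |: nbrs d.
Proof.
move=> K4; have [w wK] := clique4_outside K4.
have [d wt] := type_exists planarG K4 wK; have [_ dK] := type_notin wt.
have N : nbrs d = K :\ d.
  apply/setP => x; rewrite in_setD1 inE; apply/idP/andP => [dx|[xd xK]]; last first.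
    by case: K4 => _; apply; rewrite // eq_sym.
  rewrite eq_sym (adj_neq dx); split=> //; apply/negPn/negP => xK.
  have [t xt] := type_exists planarG K4 xK.
  have := type_untouched xt (component_refl K x).
  by rewrite -(one_type K4 wt xt) adj_sym dx.
have E : K = d |: nbrs d by rewrite N setD1K.
exists d; split=> //; split; last by rewrite -E.
by rewrite N; have := cardsD1 d K; rewrite dK; case: K4 => -> _ [].
Qed.

Lemma edge_corner x y : adj x y ->
  exists d, [/\ corner d, x \in d |: nbrs d & y \in d |: nbrs d].
Proof.
move=> xy; have [z [z' [zz xz xz' yz yz']]] := common_edge tcG triple (adj_neq xy).
have [d [cd E]] := clique4_corner (clique4_set xy xz xz' yz yz' zz).
by exists d; split=> //; rewrite -E !inE eqxx ?orbT.
Qed.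

Lemma one_type_exceptional : exists m, 3 <= m /\ isomorphic G (T m).
Proof.
have nbr x : exists y, adj x y.
  have [y] := @other_vertex _ [:: x] (ltn_trans (isT : 1 < 4) G5).
  rewrite inE eq_sym => xy; have [z [_ [_ xz _ _ _]]] := common_edge tcG triple xy.
  by exists z.
have /card_gt0P[x0 _] : 0 < #|G| by apply: leq_trans G5.
have [y0 xy0] := nbr x0; have [d [cd _ _]] := edge_corner xy0.
have [d3 K4] := cd; have [w wK] := clique4_outside K4.
have [w' ww'] := nbr w; have [d' [cd' wd' _]] := edge_corner ww'.
have dd : d != d' by apply: contraNneq wK => ->.
have [d'3 K4'] := cd'.
have clq e x y : corner e -> x \in e |: nbrs e -> y \in e |: nbrs e -> x != y -> adj x y.
  by case=> _ [_]; apply.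
have inN e x : x \in nbrs e -> x \in e |: nbrs e by move=> h; rewrite inE h orbT.
have [x [y [xy dx dy d'x d'y]]] := common_edge tcG triple dd.
have [N|N] := eqVneq (nbrs d) (nbrs d'); first exact: same_corner G5 cd cd' dd N.
have [c [cd_ cd'_]] : exists c, c \in nbrs d /\ c \notin nbrs d'.
  have : ~~ (nbrs d \subset nbrs d').
    by apply: contraNN N => s; rewrite eqEcard s d3 d'3.
  by case/subsetPn => c ? ?; exists c.
have [e [ed'_ ed_]] : exists e, e \in nbrs d' /\ e \notin nbrs d.
  have : ~~ (nbrs d' \subset nbrs d).
    by apply: contraNN N => s; rewrite eq_sym eqEcard s d3 d'3.
  by case/subsetPn => e ? ?; exists e.
(* A third corner [d''] is needed: its [K_4] contains [c] and an outer neighbour [f] of [c]. It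
   differs from [d] because of [f] and from [d'] because of [c]. *)
have [f fK cf] := corner_outer cd wK cd_.
have [d'' [cd'' cN fN]] := edge_corner cf.
have dd'' : d != d'' by apply: contraNneq fK => ->.
have c_d'' : c \in nbrs d''.
  move: cN; rewrite in_setU1 => /orP[/eqP e'|//].
  by case: (corner_independent G5 cd cd_); rewrite e'.
have d'd'' : d' != d'' by apply: contraNneq cd'_ => ->.
have xN : x \in nbrs d by rewrite inE.
have yN : y \in nbrs d by rewrite inE.
have xN' : x \in nbrs d' by rewrite inE.
have yN' : y \in nbrs d' by rewrite inE.
have xny := adj_neq xy.
have cx : c != x by apply: contraNneq cd'_ => ->.
have cy : c != y by apply: contraNneq cd'_ => ->.
have ex : e != x by apply: contraNneq ed_ => ->.
have ey : e != y by apply: contraNneq ed_ => ->.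
have three (p q r : G) v : #|nbrs v| = 3 -> uniq [:: p; q; r] ->
    p \in nbrs v -> q \in nbrs v -> r \in nbrs v -> nbrs v = [set p; q; r].
  move=> v3 un pv qv rv; apply/esym/eqP; rewrite eqEcard v3.
  have -> : #|[set p; q; r]| = 3.
    rewrite -[3]/(size [:: p; q; r]) -(card_uniqP un).
    by apply: eq_card => z; rewrite !inE -orbA.
  rewrite leqnn andbT; apply/subsetP => z; rewrite !inE -orbA.
  by move: pv qv rv; rewrite !inE => ? ? ? /or3P[]/eqP->.
have Nd : nbrs d = [set c; x; y] by apply: three; rewrite ?uniq3E ?cx ?cy.
have Nd' : nbrs d' = [set e; x; y] by apply: three; rewrite ?uniq3E ?ex ?ey.
have [x2 [y2 [xy2 d'x2 d'y2 d''x2 d''y2]]] := common_edge tcG triple d'd''.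
have [d''3 _] := cd''.
have Nd'' : nbrs d'' = [set c; x2; y2].
  apply: three => //; rewrite ?inE //.
  rewrite uniq3E (adj_neq xy2) andbT.
  by apply/andP; split; apply: contraNneq cd'_ => ->; rewrite inE.
(* If [e] is not a neighbour of [d''], the two common neighbours of [d'] and [d''] are [x] and [y],
   and [d''] has the same neighbours as [d]. *)
have [ee|ene] := boolP (e \in nbrs d''); last first.
  apply: same_corner G5 cd cd'' dd'' _; rewrite Nd Nd''; apply/esym/eqP.
  rewrite eqEcard -Nd -Nd'' d3 d''3 leqnn andbT Nd Nd''.
  have H z : adj d' z -> adj d'' z -> z \in [set c; x; y].
    move=> d'z d''z; have : z \in nbrs d' by rewrite inE.
    rewrite Nd' !inE -!orbA => /or3P[/eqP ze|->|->]; rewrite ?orbT //.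
    by move: ene; rewrite inE -ze d''z.
  apply/subsetP => z /setUP[/setUP[]|] /set1P->.
  - by rewrite !inE eqxx.
  - exact: H.
  - exact: H.
have ce : adj c e.
  apply: (clq d'') => //; try exact: inN.
  by apply: contraNneq cd'_ => ->.
have acx : adj c x by apply: (clq d) => //; apply: inN.
have acy : adj c y by apply: (clq d) => //; apply: inN.
have aex : adj e x by apply: (clq d') => //; apply: inN.
have aey : adj e y by apply: (clq d') => //; apply: inN.
(* The vertices [c], [e], [x], [y] form a [K_4], but each of them is a neighbour of the corner [d]
   or [d'], so none can be its corner. *)
have [g [cg E]] := clique4_corner (clique4_set ce acx acy aex aey xy).
have : g \in [set c; e; x; y] by rewrite E setU11.
rewrite !inE -!orbA => /or4P[]/eqP gE; rewrite gE in cg.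
- by case: (corner_independent G5 cd cd_).
- by case: (corner_independent G5 cd' ed'_).
- by case: (corner_independent G5 cd xN).
- by case: (corner_independent G5 cd yN).
Qed.

End OneType.

Lemma isomorphic_K4 K : clique4 K -> #|G| = 4 -> isomorphic G K4.
Proof.
move=> [cK clK] G4.
have KT x : x \in K.
  have /eqP -> : K == setT by rewrite eqEcard subsetT cardsT G4 cK.
  exact: in_setT.
have /card_gt0P[x0 _] : 0 < #|G| by rewrite G4.
have sz : size (enum K) = 4 by rewrite -cardE.
apply: (@isomorphic_from G K4 (fun i : 'I_4 => nth x0 (enum K) i)).
- by move=> i j /eqP; rewrite nth_uniq ?sz ?enum_uniq // => /eqP/val_inj.
- move=> x; have i4 : index x (enum K) < 4 by rewrite -sz index_mem mem_enum.
  by exists (Ordinal i4); rewrite /= nth_index // mem_enum.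
- move=> i j; rewrite -[RHS]/(i != j) -val_eqE /=.
  have [->|ne] := eqVneq (i : nat) j; first by rewrite adj_irr.
  by rewrite clK ?KT // nth_uniq ?sz ?enum_uniq.
Qed.

(** With more than four vertices, the cases are the largest number of types that occur at one [K_4]:
    at least three, two or one. *)
Lemma every_triple_exceptional : exceptional G.
Proof.
have [G4 _] := tcG.
have /card_gt1P[u [v [_ _ uv]]] : 1 < #|G| by apply: ltn_trans G4.
have [x [y [xy _ _ _ _]]] := common_edge tcG triple uv.
have [z [z' [zz xz xz' yz yz']]] := common_edge tcG triple (adj_neq xy).
have K4 := clique4_set xy xz xz' yz yz' zz.
move: G4; rewrite leq_eqVlt => /orP[/eqP G4|G5].
  by right; right; left; apply: isomorphic_K4 K4 _.
have [[K [w1 [w2 [w3 [t1 [t2 [t3 [cK h1 h2 h3 un]]]]]]]]|no3] := pselect (exists K,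
    exists w1 w2 w3 t1 t2 t3, [/\ clique4 K, has_type K w1 t1, has_type K w2 t2,
      has_type K w3 t3 & uniq [:: t1; t2; t3]]).
  have [h|h] := three_types_exceptional cK h1 h2 h3 un.
    by right; right; right; right; left.
  by right; right; right; right; right.
left; have [[K [w1 [w2 [t1 [t2 [cK h1 h2 t12]]]]]]|no2] := pselect (exists K w1 w2 t1 t2,
    [/\ clique4 K, has_type K w1 t1, has_type K w2 t2 & t1 != t2]).
  apply: (two_types_exceptional cK h1 h2 t12) => w t h.
  apply: contrapT => /not_orP[/eqP n1 /eqP n2]; apply: no3.
  exists K, w1, w2, w, t1, t2, t; split=> //.
  by rewrite uniq3E t12 eq_sym n1 eq_sym n2.
apply: one_type_exceptional => // K w w' t t' cK h h'.
by apply/eqP/negPn/negP => tt; apply: no2; exists K, w, w', t, t'.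
Qed.

End EveryTriple.

(* Assembling the values of [A] *)
From mathcomp Require Import all_classical all_reals all_analysis.

Local Open Scope classical_set_scope.
Local Open Scope nat_scope.

Lemma A_eq (G : sgraph) n (S : set nat) : (forall a, A n G a <-> S a) -> A n G = S.
Proof. by move=> h; apply/seteqP; split=> a /h. Qed.

Lemma A_empty (G : sgraph) n : #|G| < n -> A n G = set0.
Proof.
move=> Gn; apply: A_eq => a; split=> // /A_bound h.
by move: Gn; rewrite ltnNge (leq_trans (leq_addl a n) h).
Qed.

Lemma A_computed (G : sgraph) n (l l' : seq nat) :
  (forall a, A n G a <-> a \in l) -> all (mem l') l && all (mem l) l' ->
  A n G = [set` l'].
Proof.
move=> h /andP[/allP s /allP s']; apply: A_eq => a; rewrite h.
by split=> [/s|/s'].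
Qed.

Lemma set_seq2 (a b : nat) : [set` [:: a; b]] = [set a; b].
Proof.
apply/seteqP; split=> x; rewrite /= !inE.
  by case/orP=> /eqP->; [left|right].
by case=> ->; rewrite eqxx ?orbT.
Qed.

Lemma set_seq3 (a b c : nat) : [set` [:: a; b; c]] = [set a; b; c].
Proof.
apply/seteqP; split=> x; rewrite /= !inE.
  by case/or3P=> /eqP->; [left; left|left; right|right].
by case=> [[]|] ->; rewrite eqxx ?orbT.
Qed.

Lemma set_seq1 (a : nat) : [set` [:: a]] = [set a].
Proof. by apply/seteqP; split=> x; rewrite /= !inE => /eqP. Qed.

Lemma le2P a : a <= 2 <-> [set 0; 1; 2] a.
Proof.
split=> [|[[]|] ->] //; case: a => [|[|[|//]]] _ /=; by [left; left|left; right|right].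
Qed.

Lemma max_degreeP (G : sgraph) (x : G) : #|nbrs x| <= max_degree G.
Proof. exact: (leq_bigmax (F := fun x : G => #|nbrs x|)). Qed.

Section Polyhedron.
Variables (R : realType) (G : sgraph).
Hypotheses (planarG : planar R G) (tcG : three_connected G).
Hypothesis generic : ~ exceptional G.

Lemma polyhedron_A3_0 : A 3 G 0.
Proof.
apply: contrapT => nA; apply: generic; apply: (every_triple_exceptional planarG tcG).
move=> u v w un; apply: contrapT => none; apply: nA.
apply: (@A_witness0 G 3 [:: u; v; w]) => // x Hx; apply: none.
by exists x; split; apply: Hx; rewrite !inE eqxx ?orbT.
Qed.

Lemma polyhedron_A0 n : 3 <= n <= #|G| -> A n G 0.
Proof. exact: A0_mono polyhedron_A3_0. Qed.

Lemma polyhedron_le2 n a : 2 < n -> A n G a -> a <= 2.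
Proof. exact: (A_le2 (planar_K33_free planarG)). Qed.

Lemma A_of_subset (S : {set G}) n (x : G) : #|S| = n -> S \subset nbrs x ->
  exists2 a, 0 < a & A n G a.
Proof.
move=> Sn Sx; exists #|common_nbrs (enum S)|.
  apply/card_gt0P; exists x; apply/mem_common => y; rewrite mem_enum => yS.
  by have := fintype.subsetP Sx y yS; rewrite inE.
by apply/AP; exists (enum S); rewrite enum_uniq -cardE.
Qed.

Lemma A2_L n : A n G 2 -> n <= L G.
Proof.
case/AP=> u [uu <- /eqP/cards2P[x [y [xy E]]]].
apply: (common_L xy); rewrite -(card_uniqP uu); apply/subset_leq_card.
apply/fintype.subsetP => z zu; apply/mem_common => t ti.
have : t \in common_nbrs u by rewrite E; move: ti; rewrite !inE.
by move/mem_common/(_ z zu); rewrite adj_sym.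
Qed.

Lemma polyhedron_A n : 3 <= n ->
  [/\ n <= L G -> A n G = [set 0; 1; 2],
      L G < n <= max_degree G -> A n G = [set 0; 1],
      max_degree G < n <= #|G| -> A n G = [set 0]
    & #|G| < n -> A n G = set0].
Proof.
move=> n3; have [n1 n0] : 1 < n /\ 0 < n by split; apply: leq_trans n3.
have degree a : A n G a -> 0 < a -> n <= max_degree G.
  case/AP=> u [uu <- <-] /card_gt0P[x /mem_common Hx].
  apply: leq_trans (max_degreeP x); rewrite -(card_uniqP uu).
  by apply/subset_leq_card/fintype.subsetP => y yu; rewrite inE; apply: Hx.
split=> [nL|/andP[Ln nD]|/andP[Dn nG]|]; last exact: A_empty.
- have nL' : 0 < n <= L G by rewrite n0.
  have [u [v [uv nc]]] := L_common nL'.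
  have nG : n <= #|G| by apply: leq_trans nc (max_card _).
  apply: A_eq => a; rewrite -le2P; split; first exact: polyhedron_le2.
  case: a => [|[|[|//]]] _.
  + by apply: polyhedron_A0; rewrite n3.
  + apply: contrapT => nA; apply: generic.
    by apply: (no_unique_common planarG tcG _ nA); rewrite n3.
  (* Any [n] common neighbours of [u] and [v] have at least these two in common, and by
     [polyhedron_le2] no more. *)
  + have [S SC Sn] := exists_subset nc.
    apply/AP; exists (enum S); rewrite enum_uniq -cardE Sn; split=> //.
    apply/eqP; rewrite eqn_leq; apply/andP; split.
      apply: (@polyhedron_le2 n) => //; apply/AP; exists (enum S).
      by rewrite enum_uniq -cardE Sn.
    have <- : #|[set u; v]%SET| = 2 by rewrite cards2 uv.
    apply/subset_leq_card/fintype.subsetP => x xuv; apply/mem_common => y.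
    rewrite mem_enum => /(fintype.subsetP SC)/mem_common h.
    by rewrite adj_sym; apply: h; move: xuv; rewrite !inE.
- have G0 : 0 < #|G| by have [G4 _] := tcG; apply: leq_trans G4.
  have [v mv] := eq_bigmax (fun x : G => #|nbrs x|) G0.
  have nv : n <= #|nbrs v| by rewrite -mv.
  have nG : n <= #|G| by apply: leq_trans nv (max_card _).
  have A2 : ~ A n G 2 by move/A2_L; rewrite leqNgt Ln.
  have [S Sv Sn] := exists_subset nv.
  (* Any [n] neighbours of a vertex of maximum degree have a common neighbour; as [L G < n] excludes
     the value 2, the number is 1. *)
  have [b b0 Ab] := A_of_subset Sn Sv.
  have A1 : A n G 1.
    have := polyhedron_le2 n3 Ab.
    by case: b b0 Ab => [|[|[|//]]].
  apply: A_eq => a; split=> [Aa|[]->] //; last by apply: polyhedron_A0; rewrite n3.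
  have := polyhedron_le2 n3 Aa.
  by case: a Aa => [|[|[|//]]] Aa _ //=; [left|right].
- apply: A_eq => a; split=> [Aa|->]; last by apply: polyhedron_A0; rewrite n3.
  case: a Aa => // a Aa.
  by have := degree _ Aa isT; rewrite leqNgt Dn.
Qed.

End Polyhedron.

Theorem propositionA2 (R : realType) :
  (forall G : sgraph, polyhedron R G -> ~ exceptional G ->
     forall n : nat, 3 <= n ->
       [/\ n <= L G -> A n G = [set 0; 1; 2],
           L G < n <= max_degree G -> A n G = [set 0; 1],
           max_degree G < n <= #|G| -> A n G = [set 0]
         & #|G| < n -> A n G = set0])
  /\
  (forall m : nat, 3 <= m ->
     [/\ A 3 (T m) = [set 1; 2],
         forall n, 4 <= n <= m -> A n (T m) = [set 0; 1; 2],
         A m.+1 (T m) = [set 0; 1],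
         A m.+2 (T m) = [set 0]
       & forall n, m.+2 < n -> A n (T m) = set0])
  /\
  (forall (l : nat) (G : sgraph), 5 <= l -> G = B l \/ G = B' l ->
     [/\ A 3 G = [set 0; 1; 2] /\ A 4 G = [set 0; 1; 2],
         forall n, 5 <= n <= l -> A n G = [set 0; 2],
         A l.+1 G = [set 0] /\ A l.+2 G = [set 0]
       & forall n, l.+2 < n -> A n G = set0])
  /\
  [/\ A 3 K4 = [set 1],
      A 4 K4 = [set 0]
    & forall n, 5 <= n -> A n K4 = set0]
  /\
  [/\ A 3 (B 4) = [set 0; 2] /\ A 4 (B 4) = [set 0; 2],
      A 5 (B 4) = [set 0] /\ A 6 (B 4) = [set 0]
    & forall n, 7 <= n -> A n (B 4) = set0]
  /\
  [/\ A 3 S5 = [set 1; 2],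
      A 4 S5 = [set 0; 1; 2],
      A 5 S5 = [set 0; 1] /\ A 6 S5 = [set 0; 1],
      A 7 S5 = [set 0]
    & forall n, 8 <= n -> A n S5 = set0]
  /\
  [/\ A 3 S7 = [set 1; 2],
      A 4 S7 = [set 0; 1; 2],
      A 5 S7 = [set 0; 1] /\ A 6 S7 = [set 0; 1],
      A 7 S7 = [set 0] /\ A 8 S7 = [set 0]
    & forall n, 9 <= n -> A n S7 = set0].
Proof.
have cB4 : #|B 4| = 6 by rewrite card_sum !card_ord.
have cS5 : #|S5| = 7 by rewrite card_sum !card_ord.
have cS7 : #|S7| = 8 by rewrite card_sum !card_ord.
split; [|split; [|split; [|split; [|split; [|split]]]]].
- by move=> G [planarG tcG] generic n n3; apply: (polyhedron_A planarG tcG generic n3).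
- move=> m m3; have [h3 h4 hm hm2] := T_A m3.
  split=> [|n nn|||n nm]; last by apply: A_empty; rewrite card_T.
  + by apply: A_eq => a; rewrite h3.
  + by apply: A_eq => a; rewrite h4 // le2P.
  + apply: A_eq => a; rewrite hm; split=> [|[]->] //.
    by case: a => [|[|//]] _; [left|right].
  + by apply: A_eq => a; rewrite hm2.
- move=> l G l5 GB; have [h3 h5 hl] := A_bipyramid l5 GB.
  have cG : #|G| = l.+2.
    by case: GB => ->; rewrite card_sum !card_ord addn2.
  split=> [|n nn||n nl]; last by apply: A_empty; rewrite cG.
  + by split; apply: A_eq => a; rewrite h3 // le2P.
  + by apply: A_eq => a; rewrite h5.
  + by split; apply: A_eq => a; apply: hl; lia.
- split=> [||n n5]; last by apply: A_empty; rewrite card_ord.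
  (* For [K4], and likewise for [B 4], [S5] and [S7], the list [A_list] is evaluated and compared
     with the claimed values as a set. *)
  + by rewrite (A_computed (l' := [:: 1]) (A_K4 _)) ?set_seq1.
  + by rewrite (A_computed (l' := [:: 0]) (A_K4 _)) ?set_seq1.
- split=> [||n n7]; last by apply: A_empty; rewrite cB4.
  + by split; rewrite (A_computed (l' := [:: 0; 2]) (A_B4 _)) ?set_seq2.
  + by split; rewrite (A_computed (l' := [:: 0]) (A_B4 _)) ?set_seq1.
- split=> [||||n n8]; last by apply: A_empty; rewrite cS5.
  + by rewrite (A_computed (l' := [:: 1; 2]) (fun a => A_stacked _ _ a _)) ?set_seq2.
  + by rewrite (A_computed (l' := [:: 0; 1; 2]) (fun a => A_stacked _ _ a _)) ?set_seq3.
  + by split; rewrite (A_computed (l' := [:: 0; 1]) (fun a => A_stacked _ _ a _)) ?set_seq2.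
  + by rewrite (A_computed (l' := [:: 0]) (fun a => A_stacked _ _ a _)) ?set_seq1.
- split=> [||||n n9]; last by apply: A_empty; rewrite cS7.
  + by rewrite (A_computed (l' := [:: 1; 2]) (fun a => A_stacked _ _ a _)) ?set_seq2.
  + by rewrite (A_computed (l' := [:: 0; 1; 2]) (fun a => A_stacked _ _ a _)) ?set_seq3.
  + by split; rewrite (A_computed (l' := [:: 0; 1]) (fun a => A_stacked _ _ a _)) ?set_seq2.
  + by split; rewrite (A_computed (l' := [:: 0]) (fun a => A_stacked _ _ a _)) ?set_seq1.
Qed.
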